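(* Let $\pi^*\in\Pi$ be a stable Nash policy, and let $(\pi_n)_{n\ge1}$ be generated by the policy gradient template (PG) with step-size $\gamma_n=\gamma/(n+m)^{p}$, where $p\in(1/2,1]$, $\gamma>0$ and $m\ge0$, and with gradient estimates whose bias and noise bounds satisfy $B_n=O(1/n^{\ell_b})$ and $\sigma_n=O(n^{\ell_\sigma})$ with $p+\ell_b>1$ and $p-\ell_\sigma>1/2$. Then there exists a neighborhood $\mathcal U$ of $\pi^*$ in $\Pi$ such that, for every $\delta>0$, $$\mathbb P\big(\pi_n\to\pi^* \text{ as } n\to\infty \,\big|\, \pi_1\in\mathcal U\big)\ge 1-\delta,$$ provided that $\gamma$ is small enough (or $m$ large enough) relative to $\delta$.
   Context: Standing setting. Consider a finite $N$-player stochastic game with random stopping: a player set $\mathcal N=\{1,\dots,N\}$; a finite state set $\mathcal S$; for each player $i$ a finite action set $\mathcal A_i$ with $A_i=|\mathcal A_i|$, and $\mathcal A=\prod_i\mathcal A_i$; rewards $r_i:\mathcal S\times\mathcal A\to[-1,1]$; nonnegative transition weights $P(s'\mid s,a)$ such that the stopping probability $\zeta_{s,a}=1-\sum_{s'\in\mathcal S}P(s'\mid s,a)$ is positive, with $\zeta:=\min_{s,a}\zeta_{s,a}>0$; and an initial distribution $\rho\in\Delta(\mathcal S)$. A policy of player $i$ is $\pi_i=(\pi_i(\cdot\mid s))_{s\in\mathcal S}\in\Pi_i:=\Delta(\mathcal A_i)^{\mathcal S}\subset\mathbb R^{\mathcal S\times\mathcal A_i}$, and $\Pi=\prod_i\Pi_i$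 with the Euclidean norm. Given a profile $\pi$, an episode $\tau=(s_t,a_t)_{0\le t\le T(\tau)}$ is generated by: $s_0\sim\rho$; at each $t$ each player independently draws $a_{i,t}\sim\pi_i(\cdot\mid s_t)$, $a_t=(a_{i,t})_i$; then with probability $\zeta_{s_t,a_t}$ the episode stops ($T(\tau)=t$), and with probability $P(s'\mid s_t,a_t)$ it moves to $s_{t+1}=s'$. The value of player $i$ is $V_{i,s}(\pi)=\mathbb E_\pi[\sum_{t=0}^{T(\tau)}r_i(s_t,a_t)\mid s_0=s]$, $V_{i,\rho}(\pi)=\mathbb E_{s\sim\rho}V_{i,s}(\pi)$. Let $v_i(\pi)=\nabla_{\pi_i}V_{i,\rho}(\pi)$ be the gradient with respect to player $i$'s own entries $\pi_i(a_i\mid s)$ (with $V_{i,\rho}$ viewed as a smooth function on a neighborhood of $\Pi$), and $v(\pi)=(v_i(\pi))_i$. A policy $\pi^*$ is a Nash policy if $V_{i,\rho}(\pi^* )\ge V_{i,\rho}(\pi_i;\pi^*_{-i})$ for all $i$ and all $\pi_i\in\Pi_i$. A Nash policy $\pi^*$ is stable if there is a neighborhood $\mathcal V$ of $\pi^*$ in $\Pi$ with $\langle v(\pi),\pi-\pi^*\rangle<0$ for all $\pi\in\mathcal V\setminus\{\pi^*\}$. Policy gradient template (PG): $\pi_{n+1}=\mathrm{Proj}_\Pi(\pi_n+\gamma_n\hat v_n)$, $n\ge1$, where $\mathrm{Proj}_\Pi$ is Euclidean projection onto $\Pi$, $\gamma_n>0$ with $\sum_n\gamma_n=\infty$, and $\hat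 v_n$ is a random gradient estimate. With $\mathcal F_n$ the $\sigma$-algebra generated by $\pi_1,\dots,\pi_n$, write $\hat v_n=v(\pi_n)+U_n+b_n$ with $U_n=\hat v_n-\mathbb E[\hat v_n\mid\mathcal F_n]$ and $b_n=\mathbb E[\hat v_n\mid\mathcal F_n]-v(\pi_n)$, and assume $\mathbb E[\|b_n\|\mid\mathcal F_n]\le B_n$ and $\mathbb E[\|U_n\|^2\mid\mathcal F_n]\le\sigma_n^2$ for deterministic sequences $B_n,\sigma_n\ge0$. *)

(* Defs.v *)
From HB Require Import structures.
From mathcomp Require Import all_boot all_order all_algebra.
From mathcomp Require Import all_classical all_reals all_analysis.
From mathcomp Require Import measurable_realfun lebesgue_integral probability.
Set Implicit Arguments. Unset Strict Implicit. Unset Printing Implicit Defensive.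
Import Order.TTheory GRing.Theory Num.Theory.
Import numFieldNormedType.Exports.
Local Open Scope classical_set_scope.
Local Open Scope ring_scope.

Section Game.
Variables (R : realType) (N : nat) (S : finType) (A : 'I_N -> finType).

Definition joint := {dffun forall i : 'I_N, A i}.

Definition coord := {i : 'I_N & (S * A i)%type}.
Definition crd (i : 'I_N) (s : S) (b : A i) : coord :=
  @Tagged 'I_N i (fun j => (S * A j)%type) (s, b).

(* policy profiles (and their neighbourhood): vectors in R^{coord} *)
Definition pol := coord -> R.

Definition inner (u w : pol) : R := \sum_(x : coord) u x * w x.
Definition enorm (u : pol) : R := Num.sqrt (inner u u).

Definition Pi : set pol :=
  [set pi | (forall x, 0 <= pi x) /\
            (forall i s, \sum_(b : A i) pi (crd s b) = 1)].

(* prob. that the joint action a is drawn at s under profile pi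
   (a polynomial in the entries of pi, hence defined for all pi) *)
Definition polprob (pi : pol) (s : S) (a : joint) : R :=
  \prod_(j : 'I_N) pi (crd s (a j)).

Variables (r : forall i : 'I_N, S -> joint -> R)
          (P : S -> S -> joint -> R) (* P s' s a = P(s' | s, a) *)
          (rho : S -> R).

(* occ pi t s = P(s_t = s and the episode has not stopped before t) *)
Fixpoint occ (pi : pol) (t : nat) : S -> R :=
  match t with
  | 0 => rho
  | t'.+1 => fun s' => \sum_(s : S) \sum_(a : joint)
                         occ pi t' s * polprob pi s a * P s' s a
  end.

Definition step_reward (i : 'I_N) (pi : pol) (t : nat) : R :=
  \sum_(s : S) \sum_(a : joint) occ pi t s * polprob pi s a * r i s a.

(* V_{i,rho}(pi) = E_pi [ sum_{t=0}^{T} r_i(s_t,a_t) ] = sum_t E[r_i(s_t,a_t); t <= T] *)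
Definition Vrho (i : 'I_N) (pi : pol) : R :=
  lim (series (step_reward i pi) @ \oo).

(* individual gradient v_i(pi) = grad_{pi_i} V_{i,rho}(pi): the entry at
   coordinate x = (i,s,a_i) is the partial derivative of V_{i,rho} w.r.t. pi(x) *)
Definition grad (pi : pol) : pol := fun x =>
  derive1 (fun h : R => Vrho (tag x)
             (fun y => pi y + (if y == x then h else 0))) 0.

Definition is_Nash (pis : pol) : Prop :=
  Pi pis /\
  forall (i : 'I_N) (pi' : pol), Pi pi' ->
    (forall y, tag y != i -> pi' y = pis y) ->
    Vrho i pi' <= Vrho i pis.

Definition is_stable_Nash (pis : pol) : Prop :=
  is_Nash pis /\
  exists eps : R, 0 < eps /\
    forall pi, Pi pi -> pi != pis -> enorm (pi - pis) < eps ->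
      inner (grad pi) (pi - pis) < 0.

Definition nbhd_in_Pi (pis : pol) (U : set pol) : Prop :=
  U `<=` Pi /\ exists eps : R, 0 < eps /\
    [set pi | Pi pi /\ enorm (pi - pis) < eps] `<=` U.

Definition is_proj (z q : pol) : Prop :=
  Pi q /\ forall y, Pi y -> enorm (q - z) <= enorm (y - z).

End Game.

Section Proba.
Local Open Scope ereal_scope.
Variables (R : realType) (d : measure_display) (T : measurableType d)
          (Pr : probability T R).

Definition Gmeas (G : set (set T)) (f : T -> R) : Prop :=
  forall B : set R, measurable B -> G (f @^-1` B).
Definition Gmeas_e (G : set (set T)) (f : T -> \bar R) : Prop :=
  forall B : set (\bar R), measurable B -> G (f @^-1` B).

Definition is_cexp (G : set (set T)) (X Y : T -> R) : Prop :=
  Gmeas G Y /\ Pr.-integrable setT (EFin \o X) /\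
  Pr.-integrable setT (EFin \o Y) /\
  forall E, G E -> \int[Pr]_(w in E) (X w)%:E = \int[Pr]_(w in E) (Y w)%:E.

Definition is_cexp_nonneg (G : set (set T)) (Z : T -> R) (W : T -> \bar R) : Prop :=
  Gmeas_e G W /\ (forall w, 0 <= W w) /\
  forall E, G E -> \int[Pr]_(w in E) (Z w)%:E = \int[Pr]_(w in E) W w.

Definition cexp_le (G : set (set T)) (Z : T -> R) (c : R) : Prop :=
  exists W, is_cexp_nonneg G Z W /\ {ae Pr, forall w, W w <= c%:E}.
End Proba.

Section PG.
Variables (R : realType) (N : nat) (S : finType) (A : 'I_N -> finType)
          (r : forall i : 'I_N, S -> joint A -> R)
          (P : S -> S -> joint A -> R) (rho : S -> R).
Variables (d : measure_display) (T : measurableType d) (Pr : probability T R).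

Definition Fsig (pin : nat -> T -> pol R S A) (n : nat) : set (set T) :=
  <<s [set E | exists k x (B : set R), (1 <= k <= n)%N /\ measurable B /\
               E = (fun w => pin k w x) @^-1` B] >>.

Definition PG_process (gam Bb sig : nat -> R)
    (pin vhat : nat -> T -> pol R S A) : Prop :=
  (forall n x, measurable_fun setT (fun w => pin n w x)) /\
  (forall n x, measurable_fun setT (fun w => vhat n w x)) /\
  (forall w, Pi (pin 1%N w)) /\
  (forall n w, (1 <= n)%N ->
     is_proj (fun x => pin n w x + gam n * vhat n w x) (pin n.+1 w)) /\
  (forall n, (1 <= n)%N ->
     exists Y : T -> pol R S A,
       (forall x, is_cexp Pr (Fsig pin n) (fun w => vhat n w x) (fun w => Y w x)) /\
       cexp_le Pr (Fsig pin n)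
         (fun w => enorm (fun x => Y w x - grad r P rho (pin n w) x)) (Bb n) /\
       cexp_le Pr (Fsig pin n)
         (fun w => enorm (fun x => vhat n w x - Y w x) ^+ 2) (sig n ^+ 2)).

End PG.

(* Main.v *)
(* Let E_n be the squared distance from pi_n to the equilibrium.  The policy gradient
   is continuous on the compact polytope of policies, so it is bounded there and
   stability gives a drift <v(pi), pi - pi*> <= -k on every annulus around pi*.
   A projected step then yields E_(n+1) <= E_n + 2 gamma_n <v + U_n, pi_n - pi*> + eta_n
   and (E_(n+1) - E_n)^2 <= C eta_n, where the eta_n have summable conditional means.

   F_n is generated by the iterates only, so past noise is not F_n-measurable and the
   accumulated noise need not be a martingale.  Instead, the convex potentials
   ((E - a)^+)^2 of the adapted process E_n are almost supermartingales; weighted by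
   indicators of F_n-events they bound the expected number of crossings from a to b
   by (b - a)^-2 times the sum of the conditional means.  With a = R1/4 and b = R1
   this bounds the probability of ever leaving the basin, relative to P(pi_1 in U).
   Inside the basin the drift and the divergence of the step sizes force E_n below
   every eps infinitely often, and by Borel-Cantelli the crossings from eps to 4 eps
   are finitely many, so E_n tends to 0. *)
Require Import Defs.
From HB Require Import structures.
From mathcomp Require Import all_boot all_order all_algebra.
From mathcomp Require Import all_classical all_reals all_analysis.
From mathcomp Require Import measurable_realfun lebesgue_integral probability.
From mathcomp Require Import ring lra.
Import Order.TTheory GRing.Theory Num.Theory.
Import numFieldNormedType.Exports.
Local Open Scope classical_set_scope.
Local Open Scope ring_scope.
Set Implicit Arguments.
Unset Strict Implicit.
Unset Printing Implicit Defensive.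

(** * Resolvents of strictly substochastic kernels *)

Section Resolvent.
Context {R : realType} {S : finType}.
Implicit Types (K : S -> S -> R) (u rho : S -> R).

(** The value is given only as the limit of a series, so its gradient is not visible from the
    definition. Summing over joint actions turns the occupancies into row vectors rho K^t, for a
    kernel K whose absolute row sums are at most some k < 1; resolvent identities then yield a
    closed formula for the gradient, from which continuity on [Pi] and measurability along the
    random iterates are both read off.

    Only the first conditional moment of the bias is controlled, so no term quadratic in the bias
    may occur. The projection is therefore used through its variational inequality, which pairs the
    bias with bounded vectors.

    The potential with threshold R1/4 vanishes at time 0 on the starting event, so the exit bound
    has no initial term and is proportional both to the probability of that event and to the total
    noise. This is why the neighbourhood can be fixed before delta, and why small gamma and large m
    enter through one and the same inequality on the summed noise. *)

Definition rowmul K u : S -> R := fun s' => \sum_(s : S) u s * K s s'.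
(* [Occ rho K] is the occupancy vector [\sum_t rho K^t], i.e. [rho (I - K)^-1]. *)
Definition Occ rho K (s : S) : R :=
  lim (series (fun t => iter t (rowmul K) rho s) @ \oo).
Definition l1norm u : R := \sum_(s : S) `|u s|.
Definition row_bounded (k : R) K := forall s, \sum_(s' : S) `|K s s'| <= k.

Lemma l1norm_ge0 u : 0 <= l1norm u. Proof. exact: sumr_ge0. Qed.

Lemma le_l1norm u s : `|u s| <= l1norm u.
Proof. by rewrite /l1norm (bigD1 s) //= lerDl; exact: sumr_ge0. Qed.

Lemma l1norm_eq0 u : l1norm u <= 0 -> forall s, u s = 0.
Proof. by move=> u0 s; apply/eqP; rewrite -normr_le0 (le_trans (le_l1norm u s)). Qed.

Lemma l1normD u w : l1norm (fun s => u s + w s) <= l1norm u + l1norm w.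
Proof. by rewrite /l1norm -big_split; apply: ler_sum => s _; exact: ler_normD. Qed.

Lemma l1norm_rowmul k K u : row_bounded k K -> l1norm (rowmul K u) <= k * l1norm u.
Proof.
move=> hK.
apply: (@le_trans _ _ (\sum_s' \sum_s `|u s| * `|K s s'|)).
  by apply: ler_sum => s' _; apply: le_trans (ler_norm_sum _ _ _) _;
    apply: ler_sum => s _; rewrite normrM.
rewrite exchange_big /= mulr_sumr; apply: ler_sum => s _.
by rewrite -mulr_sumr mulrC ler_wpM2r.
Qed.

Lemma l1norm_iter k K rho t : 0 <= k -> row_bounded k K ->
  l1norm (iter t (rowmul K) rho) <= k ^+ t * l1norm rho.
Proof.
move=> k0 hK; elim: t => [|t IH]; first by rewrite expr0 mul1r.
apply: le_trans (l1norm_rowmul _ hK) _ => /=.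
by rewrite exprS -mulrA; apply: ler_wpM2l.
Qed.

Lemma Occ_cvg k K rho s : 0 <= k < 1 -> row_bounded k K ->
  series (fun t => iter t (rowmul K) rho s) @ \oo --> Occ rho K s.
Proof.
move=> /andP[k0 k1] hK; apply: normed_cvg.
apply: (@series_le_cvg _ _ (fun t => l1norm rho * k ^+ t)).
- by move=> n; exact: normr_ge0.
- by move=> n; rewrite mulr_ge0 ?l1norm_ge0 ?exprn_ge0.
- move=> n; apply: le_trans (le_l1norm _ _) _; rewrite mulrC; exact: l1norm_iter.
- by apply: is_cvg_geometric_series; rewrite ger0_norm.
Qed.

Lemma cvg_sumr (T : Type) (F : set_system T) (I : finType) (P : pred I)
    (f : I -> T -> R) (l : I -> R) : Filter F ->
  (forall i, P i -> f i t @[t --> F] --> l i) ->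
  (\sum_(i | P i) f i t) @[t --> F] --> \sum_(i | P i) l i.
Proof. by move=> FF h; apply: cvg_big => //; exact: add_continuous. Qed.

Lemma cvg_prodr (T : Type) (F : set_system T) (I : finType) (P : pred I)
    (f : I -> T -> R) (l : I -> R) : Filter F ->
  (forall i, P i -> f i t @[t --> F] --> l i) ->
  (\prod_(i | P i) f i t) @[t --> F] --> \prod_(i | P i) l i.
Proof. by move=> FF h; apply: cvg_big => //; exact: mul_continuous. Qed.

Lemma Occ_fix k K rho s : 0 <= k < 1 -> row_bounded k K ->
  Occ rho K s = rho s + rowmul K (Occ rho K) s.
Proof.
move=> hk hK.
have h1 : (series (fun t => iter t (rowmul K) rho s) n.+1) @[n --> \oo]
    --> Occ rho K s by rewrite cvg_shiftS; exact: Occ_cvg hk hK.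
have h2 : (rho s + \sum_s1 series (fun t => iter t (rowmul K) rho s1) n * K s1 s)
    @[n --> \oo] --> rho s + rowmul K (Occ rho K) s.
  apply: cvgD; first exact: cvg_cst.
  apply: cvg_sumr => s1 _; apply: cvgMl; exact: Occ_cvg hk hK.
apply: (cvg_unique _ h1); rewrite //=.
apply: cvg_trans h2; apply: near_eq_cvg; apply: nearW => n.
rewrite /series /= big_nat_recl //=; congr (_ + _).
under eq_bigr do rewrite mulr_suml.
by rewrite exchange_big.
Qed.

(** Since [k < 1], the term [k * l1norm u] produced by the equation is absorbed on the left. The
    estimate serves with zero source for uniqueness and with a small source for continuity. *)
Lemma l1norm_fix k K rho u : k < 1 -> row_bounded k K ->
  (forall s, u s = rho s + rowmul K u s) -> l1norm u <= l1norm rho / (1 - k).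
Proof.
move=> k1 hK hu; rewrite ler_pdivlMr ?subr_gt0 //.
have : l1norm u <= l1norm rho + k * l1norm u.
  apply: le_trans (lerD (lexx _) (l1norm_rowmul u hK)).
  by rewrite {1}(_ : u = (fun s => rho s + rowmul K u s)) ?l1normD //; apply/funext.
by rewrite mulrBr mulr1 lerBlDr [l1norm u * k]mulrC.
Qed.

(** This recognises an occupancy vector from its equation alone, without summing a series; the
    difference quotient in [Occ_derivative] is identified in this way. *)
Lemma Occ_unique k K rho u : 0 <= k < 1 -> row_bounded k K ->
  (forall s, u s = rho s + rowmul K u s) -> forall s, u s = Occ rho K s.
Proof.
move=> hk hK hu s; apply/eqP; rewrite -subr_eq0; apply/eqP.
have [_ k1] := andP hk.
apply: (l1norm_eq0 (u := fun s => u s - Occ rho K s)).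
have := @l1norm_fix k K (fun=> 0) (fun s => u s - Occ rho K s) k1 hK.
rewrite {2}/l1norm big1 ?mul0r => [|i _]; last by rewrite normr0.
apply => s1; rewrite hu (Occ_fix _ _ hk hK) /rowmul add0r.
under [RHS]eq_bigr do rewrite mulrBl.
by rewrite sumrB opprD addrACA subrr add0r.
Qed.

(* The difference [w] of two occupancy vectors solves [w = f + w K] with a small
   source [f], so [l1norm_fix] bounds it. *)
Lemma Occ_continuous k (T : Type) (F : set_system T) (rhot : T -> S -> R)
    (Kt : T -> S -> S -> R) rho K : ProperFilter F -> 0 <= k < 1 ->
  row_bounded k K -> (\forall t \near F, row_bounded k (Kt t)) ->
  (forall s, rhot t s @[t --> F] --> rho s) ->
  (forall s s', Kt t s s' @[t --> F] --> K s s') ->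
  forall s, Occ (rhot t) (Kt t) s @[t --> F] --> Occ rho K s.
Proof.
move=> FF hk hK hKt hrho hKK s; have [_ k1] := andP hk.
pose mu := Occ rho K.
pose f t s' := (rhot t s' - rho s') + \sum_s1 mu s1 * (Kt t s1 s' - K s1 s').
have f0 : l1norm (f t) / (1 - k) @[t --> F] --> (0 : R).
  rewrite -(mul0r (1 - k)^-1); apply: cvgMl.
  have -> : 0 = \sum_(s1 : S) `|(0 : R) + \sum_(s2 : S) mu s2 * 0|.
    by rewrite big1 // => i _; rewrite big1 ?addr0 ?normr0 // => j _; rewrite mulr0.
  apply: (@cvg_sumr _ _ _ _ (fun s1 t => `|f t s1|)) => s1 _; apply: cvg_norm; apply: cvgD.
    by rewrite -(subrr (rho s1)); apply: cvgB => //; exact: cvg_cst.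
  apply: cvg_sumr => s2 _; apply: cvgMr.
  by rewrite -(subrr (K s2 s1)); apply: cvgB => //; exact: cvg_cst.
apply/cvgrPdist_lt => e e0.
near=> t.
rewrite distrC; apply: (@le_lt_trans _ _ (l1norm (f t) / (1 - k))); last first.
  by near: t; exact: (cvgr_lt 0 f0).
apply: le_trans (le_l1norm (fun s => Occ (rhot t) (Kt t) s - Occ rho K s) _) _.
have hKtt : row_bounded k (Kt t) by near: t.
apply: (l1norm_fix k1 hKtt) => s1.
rewrite (Occ_fix _ _ hk hKtt) (Occ_fix _ _ hk hK) /f /rowmul -/mu.
under [X in _ = _ + X]eq_bigr do rewrite mulrBl.
under [X in _ = _ + X + _]eq_bigr do rewrite mulrBr.
rewrite !sumrB; lra.
Unshelve. all: by end_near. Qed.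

Lemma Occ_measurable k d (T : measurableType d) (rhot : T -> S -> R)
    (Kt : T -> S -> S -> R) : 0 <= k < 1 -> (forall t, row_bounded k (Kt t)) ->
  (forall s, measurable_fun setT (fun t => rhot t s)) ->
  (forall s s', measurable_fun setT (fun t => Kt t s s')) ->
  forall s, measurable_fun setT (fun t => Occ (rhot t) (Kt t) s).
Proof.
move=> hk hKt mrho mK s.
apply: (@measurable_fun_cvg _ _ _ _
  (fun n t => series (fun i => iter i (rowmul (Kt t)) (rhot t) s) n)); last first.
  move=> t _; exact: Occ_cvg hk (hKt t).
move=> n; rewrite /series /=; apply: measurable_sum => i.
elim: i s => [|i IH] s //=.
by apply: measurable_sum => s1; apply: measurable_funM.
Qed.

(* The difference quotient of [Occ] is itself an occupancy vector, with initial
   vector [Occ rho (K + h K1) K1]; this avoids backward value functions. *)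
Lemma Occ_derivative k rho K K1 (u u1 : S -> R) : 0 <= k < 1 ->
  row_bounded k K ->
  let val h := \sum_s Occ rho (fun s s' => K s s' + h * K1 s s') s
                  * (u s + h * u1 s) in
  (\forall h \near (0 : R), row_bounded k (fun s s' => K s s' + h * K1 s s')) ->
  derive1 val 0 =
    (\sum_s (Occ (rowmul K1 (Occ rho K)) K s * u s + Occ rho K s * u1 s)).
Proof.
move=> hk hK val hnear.
pose Kh (h : R) s s' := K s s' + h * K1 s s'.
have K0 : Kh 0 = K by apply/funext => s; apply/funext => s'; rewrite /Kh mul0r addr0.
have cK s s' : Kh h s s' @[h --> 0^'] --> K s s'.
  rewrite -[X in _ --> X]addr0 -[X in _ --> _ + X](mul0r (K1 s s')).
  apply: cvgD; first exact: cvg_cst.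
  by apply: cvgMl; apply: cvg_within_filter; exact: cvg_id.
have hn : \forall h \near (0 : R)^', row_bounded k (Kh h) by exact: nbhs_dnbhs hnear.
have cO s : Occ rho (Kh h) s @[h --> 0^'] --> Occ rho K s.
  by apply: Occ_continuous hk hK hn _ _ _ => // s1; exact: cvg_cst.
have cO2 s : Occ (rowmul K1 (Occ rho (Kh h))) K s @[h --> 0^']
    --> Occ (rowmul K1 (Occ rho K)) K s.
  have hK' : \forall h \near (0 : R)^', row_bounded k K by exact: nearW.
  apply: Occ_continuous hk hK hK' _ _ _.
  - by move=> s1; apply: cvg_sumr => s2 _; apply: cvgMl.
  - by move=> s1 s2; exact: cvg_cst.
have key : \forall h \near (0 : R)^', forall s, Occ rho (Kh h) s =
    Occ rho K s + h * Occ (rowmul K1 (Occ rho (Kh h))) K s.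
  near=> h; have h0 : h != 0 by near: h; exact: nbhs_dnbhs_neq.
  have hh : row_bounded k (Kh h) by near: h.
  move=> s.
  have <- : (Occ rho (Kh h) s - Occ rho K s) / h
      = Occ (rowmul K1 (Occ rho (Kh h))) K s; last by field.
  apply: (Occ_unique (u := fun s => (Occ rho (Kh h) s - Occ rho K s) / h) hk hK).
  move=> s1; rewrite (Occ_fix _ _ hk hh) (Occ_fix _ _ hk hK) /rowmul.
  under [X in _ = _ + X]eq_bigr do rewrite mulrAC mulrBl.
  rewrite -mulr_suml sumrB /Kh.
  under [X in (_ + X - _) / _]eq_bigr do rewrite mulrDr mulrCA.
  rewrite big_split -mulr_sumr /=.
  by field.
rewrite /derive1; apply: cvg_lim => //.
apply: (@cvg_trans _ ((\sum_s (Occ (rowmul K1 (Occ rho (Kh h))) K s * u s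
    + Occ rho (Kh h) s * u1 s)) @[h --> 0^'])); last first.
  by apply: cvg_sumr => s _; apply: cvgD; apply: cvgMl.
apply: near_eq_cvg; near=> h.
have h0 : h != 0 by near: h; exact: nbhs_dnbhs_neq.
have hkey : forall s, Occ rho (Kh h) s =
    Occ rho K s + h * Occ (rowmul K1 (Occ rho (Kh h))) K s by near: h.
rewrite addr0 /val -/(Kh h) -/(Kh 0) K0 -sumrB /GRing.scale /= mulr_sumr.
apply: eq_bigr => s _; rewrite mul0r addr0.
move: (hkey s); set x := Occ _ K _; set y := Occ rho _ _; move=> ->; by field.
Unshelve. all: by end_near. Qed.

End Resolvent.

(** * The policy gradient *)

Section PolicyGradient.
Context {R : realType} {N : nat} {S : finType} {A : 'I_N -> finType}.
Variables (r : forall i : 'I_N, S -> joint A -> R)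
  (P : S -> S -> joint A -> R) (rho : S -> R).
Hypothesis hP : forall s' s a, 0 <= P s' s a.
Hypothesis hzeta : forall s a, 0 < 1 - \sum_(s' : S) P s' s a.
Implicit Types (pi : pol R S A) (x y : Defs.coord S A).

(** Distributivity over a dependent product: joint actions are transported to [fprod], where a sum
    over choice functions is a product of sums. *)
Lemma prod_sum_dffun (f : forall j, A j -> R) :
  \sum_(a : joint A) \prod_j f j (a j) = \prod_j \sum_(b : A j) f j b.
Proof.
rewrite (reindex (@dffun_of_fprod _ A)); last exact/onW_bij/dffun_of_fprod_bij.
pose g i := [ffun b => f i b].
transitivity (\sum_(t : fprod A) \prod_i g i (t i)).
  by apply: eq_bigr => t _; apply: eq_bigr => i _; rewrite !ffunE.
rewrite (@big_fprod _ _ _ _ _ _ _ g) /=.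
transitivity (\prod_j \sum_(u in tagged_with A j) untag 0 (g j) u).
  by rewrite bigA_distr_big_dep.
apply: eq_bigr => j _; rewrite [RHS](eq_bigr (g j)) => [|b _]; last by rewrite ffunE.
by rewrite (@big_tag _ _ _ _ A (fun i => g i) j).
Qed.

Lemma polprob_sum1 pi s : Pi pi -> \sum_a polprob pi s a = 1.
Proof.
move=> [_ h1]; rewrite (@prod_sum_dffun (fun j b => pi (crd s b))).
by rewrite big1.
Qed.

Lemma polprob_ge0 pi s a : Pi pi -> 0 <= polprob pi s a.
Proof. by move=> [h0 _]; apply: prodr_ge0. Qed.

(** The coefficient of the entry [x] in the multilinear polynomial [polprob], that is, its partial
    derivative. *)
Definition dpol x pi s (a : joint A) : R :=
  if crd s (a (tag x)) == x then \prod_(j | j != tag x) pi (crd s (a j)) else 0.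

Lemma polprob_affine x pi s a h :
  polprob (fun y => pi y + (if y == x then h else 0)) s a
  = polprob pi s a + h * dpol x pi s a.
Proof.
rewrite /polprob (bigD1 (tag x)) //= [in RHS](bigD1 (tag x)) //= /dpol.
set p1 := (X in _ * X = _); set p2 := (X in _ = _ * X + _).
have -> : p1 = p2.
  apply: eq_bigr => j jx; case: eqP => [e|_]; last by rewrite addr0.
  by move: jx; rewrite -e eqxx.
by case: eqP => _; [rewrite mulrDl|rewrite mulr0 !addr0].
Qed.

Definition trans (w : S -> joint A -> R) s s' : R := \sum_a w s a * P s' s a.
Definition rew (i : 'I_N) (w : S -> joint A -> R) s : R := \sum_a w s a * r i s a.

(** The hypothesis is a row bound rather than [Pi pi], because a partial derivative evaluates the
    value at profiles that leave the polytope in one entry. *)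
Lemma VrhoE k i pi : 0 <= k < 1 -> row_bounded k (trans (polprob pi)) ->
  Vrho r P rho i pi =
  \sum_s Occ rho (trans (polprob pi)) s * rew i (polprob pi) s.
Proof.
move=> hk hK; rewrite /Vrho; apply: cvg_lim => //.
have occE t : occ P rho pi t = iter t (rowmul (trans (polprob pi))) rho.
  elim: t => //= t ->; apply/funext => s'; apply: eq_bigr => s _.
  by rewrite mulr_sumr; apply: eq_bigr => a _; rewrite mulrA.
apply: (@cvg_trans _ ((\sum_s (series
   (fun t => iter t (rowmul (trans (polprob pi))) rho s) n) *
   rew i (polprob pi) s) @[n --> \oo])); last first.
  by apply: cvg_sumr => s _; apply: cvgMl; exact: Occ_cvg hk hK.
apply: near_eq_cvg; apply: nearW => n; rewrite /series /step_reward /=.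
under eq_bigr do rewrite mulr_suml.
rewrite exchange_big /=; apply: eq_bigr => t _; apply: eq_bigr => s _.
by rewrite occE /rew mulr_sumr; apply: eq_bigr => a _; rewrite mulrA.
Qed.

Lemma survival_bound : exists2 k : R, 0 <= k < 1 &
  forall s a, \sum_(s' : S) P s' s a <= k.
Proof.
exists (\big[Num.max/0]_(u : S * joint A) \sum_(s' : S) P s' u.1 u.2).
  apply/andP; split; first by rewrite bigmax_ge_id.
  by apply: bigmax_lt => // u _; rewrite -subr_gt0.
by move=> s a; apply: (le_bigmax _ (fun u : S * joint A => \sum_s' P s' u.1 u.2) (s, a)).
Qed.

Lemma trans_row_bounded k pi : (forall s a, \sum_(s' : S) P s' s a <= k) ->
  Pi pi -> row_bounded k (trans (polprob pi)).
Proof.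
move=> hk hpi s.
apply: (@le_trans _ _ (\sum_s' trans (polprob pi) s s')).
  apply: ler_sum => s' _; rewrite ger0_norm //.
  by apply: sumr_ge0 => a _; rewrite mulr_ge0 // polprob_ge0.
rewrite exchange_big /=.
under eq_bigr do rewrite -mulr_sumr.
rewrite -[leRHS]mul1r -(polprob_sum1 s hpi) mulr_suml.
by apply: ler_sum => a _; apply: ler_wpM2l => //; exact: polprob_ge0.
Qed.

(* Policy gradient formula: each entry of [pi] enters [polprob] affinely, with
   slope [dpol]. *)
Definition gradF pi x : R :=
  let mu := Occ rho (trans (polprob pi)) in
  \sum_s (Occ (rowmul (trans (dpol x pi)) mu) (trans (polprob pi)) s
            * rew (tag x) (polprob pi) s + mu s * rew (tag x) (dpol x pi) s).

Lemma row_bounded_near k K (K1 : S -> S -> R) (k' : R) : k < k' ->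
  row_bounded k K ->
  \forall h \near (0 : R), row_bounded k' (fun s s' => K s s' + h * K1 s s').
Proof.
move=> kk hK; pose C := 1 + \sum_s \sum_s' `|K1 s s'|.
have C0 : 0 < C by rewrite ltr_wpDr // sumr_ge0 // => s _; exact: sumr_ge0.
near=> h => s.
apply: (@le_trans _ _ (\sum_s' (`|K s s'| + `|h| * `|K1 s s'|))).
  by apply: ler_sum => s' _; rewrite -normrM ler_normD.
rewrite big_split -mulr_sumr /= -(subrK k k') addrC lerD //.
apply: (@le_trans _ _ (`|h| * C)).
  apply: ler_wpM2l => //.
  have : \sum_s' `|K1 s s'| <= \sum_s1 \sum_s' `|K1 s1 s'|.
    by rewrite [leRHS](bigD1 s) //= lerDl sumr_ge0 // => s1 _; exact: sumr_ge0.
  by rewrite /C; lra.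
rewrite -ler_pdivlMr //; apply: ltW; near: h.
have e0 : 0 < (k' - k) / C by rewrite divr_gt0 // subr_gt0. exact: (@nbhs0_lt _ R^o _ e0).
Unshelve. all: by end_near. Qed.

Lemma gradE pi x : Pi pi -> grad r P rho pi x = gradF pi x.
Proof.
move=> hpi; have [k0 /andP[k00 k01] hk0] := survival_bound.
(* Shifting one entry may push the row sums above [k0]; a bound halfway to 1 leaves room for all
   small [h]. *)
pose k := (k0 + 1) / 2.
have kk : k0 < k by rewrite /k; lra.
have hk : 0 <= k < 1 by rewrite /k; lra.
have hK : row_bounded k (trans (polprob pi)).
  by move=> s; apply: le_trans (ltW kk); exact: trans_row_bounded.
have hnear := row_bounded_near (trans (dpol x pi)) kk (trans_row_bounded hk0 hpi).
have transh h : trans (polprob (fun y => pi y + (if y == x then h else 0)))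
   = fun s s' => trans (polprob pi) s s' + h * trans (dpol x pi) s s'.
  apply/funext => s; apply/funext => s'; rewrite /trans mulr_sumr -big_split.
  by apply: eq_bigr => a _; rewrite polprob_affine mulrDl mulrA.
rewrite /gradF -(Occ_derivative rho (rew (tag x) (polprob pi)) (rew (tag x) (dpol x pi))
  hk hK hnear) /grad !derive1E.
apply: near_eq_derive => //; near=> h.
rewrite (@VrhoE k _ _ hk); last by rewrite transh; near: h.
rewrite transh; apply: eq_bigr => s _; congr (_ * _).
rewrite /rew mulr_sumr -big_split.
by apply: eq_bigr => a _; rewrite polprob_affine mulrDl mulrA.
Unshelve. all: by end_near. Qed.

(** An arbitrary proper filter is allowed, since compactness will supply limits along an ultrafilter
    and not along a subsequence. *)
Lemma grad_cvg (T : Type) (F : set_system T) (pit : T -> pol R S A) pi x :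
  ProperFilter F -> Pi pi -> (\forall t \near F, Pi (pit t)) ->
  (forall y, pit t y @[t --> F] --> pi y) ->
  grad r P rho (pit t) x @[t --> F] --> grad r P rho pi x.
Proof.
move=> FF hpi hpit cpi; have [k hk hk0] := survival_bound.
apply: (@cvg_trans _ (gradF (pit t) x @[t --> F])).
  by apply: near_eq_cvg; apply: filterS hpit => t /gradE ->.
rewrite gradE // /gradF.
have cpol s a : polprob (pit t) s a @[t --> F] --> polprob pi s a.
  by apply: cvg_prodr.
have cdpol s a : dpol x (pit t) s a @[t --> F] --> dpol x pi s a.
  by rewrite /dpol; case: ifP => _; [exact: cvg_prodr|exact: cvg_cst].
have ctrans s s' : trans (polprob (pit t)) s s' @[t --> F] --> trans (polprob pi) s s'.
  by apply: cvg_sumr => a _; exact: cvgMl.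
have ctrans1 s s' : trans (dpol x (pit t)) s s' @[t --> F] --> trans (dpol x pi) s s'.
  by apply: cvg_sumr => a _; exact: cvgMl.
have hn : \forall t \near F, row_bounded k (trans (polprob (pit t))).
  by apply: filterS hpit => t; exact: trans_row_bounded.
have hb := trans_row_bounded hk0 hpi.
have cO s : Occ rho (trans (polprob (pit t))) s @[t --> F]
   --> Occ rho (trans (polprob pi)) s.
  by apply: Occ_continuous hk hb hn _ _ _ => // s1; exact: cvg_cst.
apply: cvg_sumr => s _; apply: cvgD; apply: cvgM => //.
- apply: Occ_continuous hk hb hn _ _ _ => // s1.
  by apply: cvg_sumr => s2 _; exact: cvgM.
- by apply: cvg_sumr => a _; exact: cvgMl.
- by apply: cvg_sumr => a _; exact: cvgMl.
Qed.

Lemma measurable_grad d (T : measurableType d) (pit : T -> pol R S A) x :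
  (forall t, Pi (pit t)) -> (forall y, measurable_fun setT (fun t => pit t y)) ->
  measurable_fun setT (fun t => grad r P rho (pit t) x).
Proof.
move=> hpi mpi; have [k hk hk0] := survival_bound.
have -> : (fun t => grad r P rho (pit t) x) = (fun t => gradF (pit t) x).
  by apply/funext => t; rewrite gradE.
have mpol s a : measurable_fun setT (fun t => polprob (pit t) s a).
  by apply: measurable_prod.
have mdpol s a : measurable_fun setT (fun t => dpol x (pit t) s a).
  rewrite /dpol; case: (crd s (a (tag x)) == x); last exact: measurable_cst.
  have -> : (fun t => \prod_(j | j != tag x) pit t (crd s (a j)))
      = (fun t => \prod_j if j != tag x then pit t (crd s (a j)) else 1).
    by apply/funext => t; rewrite big_mkcond.
  by apply: measurable_prod => j _; case: (j != tag x).
have hb t := trans_row_bounded hk0 (hpi t).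
have mtr s s' : measurable_fun setT (fun t => trans (polprob (pit t)) s s').
  by apply: measurable_sum => a; exact: measurable_funM.
have mO s : measurable_fun setT (fun t => Occ rho (trans (polprob (pit t))) s).
  exact: (Occ_measurable hk hb).
apply: measurable_sum => s; apply: measurable_funD; apply: measurable_funM => //.
- apply: (Occ_measurable hk hb) => // s1.
  apply: measurable_sum => s2; apply: measurable_funM => //.
  by apply: measurable_sum => a; exact: measurable_funM.
- by apply: measurable_sum => a; exact: measurable_funM.
- by apply: measurable_sum => a; exact: measurable_funM.
Qed.

End PolicyGradient.

(** * Projected steps and the drift towards the equilibrium *)

Section Geometry.
Context {R : realType} {N : nat} {S : finType} {A : 'I_N -> finType}.
Implicit Types (u v w y z : pol R S A) (x : Defs.coord S A).

Lemma innerC u v : inner u v = inner v u.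
Proof. by apply: eq_bigr => x _; rewrite mulrC. Qed.

Lemma innerDl u v w : inner (u + v) w = inner u w + inner v w.
Proof. by rewrite /inner -big_split; apply: eq_bigr => x _; rewrite mulrDl. Qed.

Lemma innerDr u v w : inner u (v + w) = inner u v + inner u w.
Proof. by rewrite innerC innerDl !(innerC u). Qed.

Definition scale (c : R) u : pol R S A := fun x => c * u x.

Lemma innerZl (c : R) u v : inner (scale c u) v = c * inner u v.
Proof. by rewrite /inner mulr_sumr; apply: eq_bigr => x _; rewrite mulrA. Qed.

Lemma innerZr (c : R) u v : inner u (scale c v) = c * inner u v.
Proof. by rewrite innerC innerZl innerC. Qed.

Lemma inner_sqrD u v :
  inner (u + v) (u + v) = inner u u + 2 * inner u v + inner v v.
Proof. by rewrite innerDl !innerDr (innerC v u); ring. Qed.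

Lemma innerNl u v : inner (- u) v = - inner u v.
Proof. by rewrite /inner -sumrN; apply: eq_bigr => x _; rewrite mulNr. Qed.

Lemma innerNr u v : inner u (- v) = - inner u v.
Proof. by rewrite innerC innerNl innerC. Qed.

Lemma inner_ge0 u : 0 <= inner u u.
Proof. by apply: sumr_ge0 => x _; rewrite -expr2 sqr_ge0. Qed.

Lemma enorm_ge0 u : 0 <= enorm u. Proof. exact: sqrtr_ge0. Qed.

Lemma enorm_sqr u : enorm u ^+ 2 = inner u u.
Proof. by rewrite sqr_sqrtr ?inner_ge0. Qed.

Lemma le_enorm u x : `|u x| <= enorm u.
Proof.
rewrite -(@ler_pXn2r _ 2) ?nnegrE ?enorm_ge0 // enorm_sqr /inner (bigD1 x) //=.
by rewrite -expr2 real_normK ?num_real // lerDl sumr_ge0 // => y _; rewrite -expr2 sqr_ge0.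
Qed.

Lemma inner_amgm u v : 2 * inner u v <= inner u u + inner v v.
Proof.
have := inner_ge0 (u - v).
rewrite inner_sqrD !innerNr !innerNl; lra.
Qed.

Definition dimc : R := #|{: Defs.coord S A}|%:R.

Lemma inner_le_enorm (c : R) u v : (forall x, `|v x| <= c) ->
  inner u v <= c * dimc * enorm u.
Proof.
move=> hv; apply: (@le_trans _ _ (\sum_(x : Defs.coord S A) c * enorm u)).
  apply: ler_sum => x _; apply: le_trans (ler_norm _) _; rewrite normrM mulrC.
  by apply: ler_pM => //; exact: le_enorm.
by rewrite sumr_const -mulr_natr mulrAC.
Qed.

Lemma Pi_bounds u x : Pi u -> 0 <= u x <= 1.
Proof.
move=> [h0 h1]; rewrite h0 /=; case: x => i [s b].
by rewrite -(h1 i s) (bigD1 b) //= lerDl sumr_ge0.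
Qed.

Lemma Pi_sub_bound u v x : Pi u -> Pi v -> `|(u - v) x| <= 1.
Proof.
move=> /(Pi_bounds x) hu /(Pi_bounds x) hv; rewrite ler_norml.
by have -> : (u - v) x = u x - v x by []; lra.
Qed.

Lemma Pi_sqdist_le u v : Pi u -> Pi v -> inner (u - v) (u - v) <= dimc.
Proof.
move=> hu hv; rewrite /dimc -sumr_const; apply: ler_sum => x _.
have := Pi_sub_bound x hu hv; rewrite ler_norml => h; nra.
Qed.

Lemma Pi_convex u v (t : R) : Pi u -> Pi v -> 0 <= t <= 1 ->
  Pi (fun x => u x + t * (v x - u x)).
Proof.
move=> [u0 u1] [v0 v1] ht; split=> [x|i s].
  by have := u0 x; have := v0 x; nra.
by rewrite big_split -mulr_sumr sumrB /= u1 v1 subrr mulr0 addr0.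
Qed.

(** Otherwise a short move from [q] towards [y] stays in the polytope by convexity and comes
    strictly closer to [z]. *)
Lemma proj_variational z (q : pol R S A) y : is_proj z q -> Pi y -> 0 <= inner (q - z) (y - q).
Proof.
move=> [hq hmin] hy; rewrite leNgt; apply/negP => c0.
set c := inner _ _ in c0; pose D := inner (y - q) (y - q).
have D0 : 0 <= D by exact: inner_ge0.
(* For this [t] the squared distance to [z] changes by [2 * t * c + t ^+ 2 * D = t * c + t ^+ 2 *
   c], which is negative; the denominator is positive even if [D = 0]. *)
pose t := - c / (D - c).
have Dc : 0 < D - c by lra.
have tDc : t * (D - c) = - c by rewrite /t divfK // gt_eqF.
have t0 : 0 < t by rewrite divr_gt0 // oppr_gt0.
have t1 : t <= 1 by rewrite ler_pdivrMr // mul1r; lra.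
have := hmin _ (Pi_convex hq hy (introT andP (conj (ltW t0) t1))).
rewrite -(@ler_pXn2r _ 2) ?nnegrE ?enorm_ge0 // !enorm_sqr.
have -> : (fun x => q x + t * (y x - q x)) - z = (q - z) + scale t (y - q).
  by apply/funext => x; rewrite /scale /= !fctE; ring.
rewrite (inner_sqrD (q - z) (scale t (y - q))) !innerZr innerZl -/c -/D.
have -> : t * D = t * c - c by rewrite -tDc; ring.
have tc : t * c < 0 by rewrite pmulr_rlt0.
have ttc : t * (t * c) < 0 by rewrite pmulr_rlt0.
lra.
Qed.

(** * One projected step: displacement and change of energy *)

Section Step.
Variables (pis pi q v U b : pol R S A) (g : R).
Hypotheses (hpis : Pi pis) (hpi : Pi pi) (g0 : 0 <= g)
  (hq : is_proj (fun x => pi x + g * (v x + b x + U x)) q).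
(* The bias enters [eta] to the first power only (at the price of the diameter of
   the polytope), since only its first conditional moment is controlled. *)
Let eta := g ^+ 2 * inner (v + U) (v + U) + 4 * g * dimc * enorm b.

Let hvar (y : pol R S A) : Pi y ->
  g * (inner (v + U) (y - q) + inner b (y - q)) <= inner (q - pi) (y - q).
Proof.
move=> /(proj_variational hq).
have -> : q - (fun x => pi x + g * (v x + b x + U x))
    = (q - pi) + - scale g (v + U + b).
  by apply/funext => x; rewrite /scale /= !fctE; ring.
by rewrite innerDl innerNl innerZl !innerDl; lra.
Qed.

Let hqPi : Pi q. Proof. by have [] := hq. Qed.

Lemma proj_step_amgm :
  2 * g * inner (v + U) (q - pi) <=
    g ^+ 2 * inner (v + U) (v + U) + inner (q - pi) (q - pi).
Proof.
have := inner_amgm (scale g (v + U)) (q - pi).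
by rewrite innerZr !innerZl; lra.
Qed.

Lemma bias_bound (y1 y2 : pol R S A) : Pi y1 -> Pi y2 -> inner b (y1 - y2) <= dimc * enorm b.
Proof.
move=> h1 h2; rewrite -[leRHS]mul1r mulrA; apply: inner_le_enorm => x.
exact: Pi_sub_bound.
Qed.

(** The variational inequality at [y = pi], doubled, bounds two copies of the squared displacement,
    and [proj_step_amgm] takes back only one. *)
Lemma proj_step_displacement : inner (q - pi) (q - pi) <= eta.
Proof.
have := hvar hpi; have := proj_step_amgm; have := bias_bound hqPi hpi.
have -> : pi - q = - (q - pi) by rewrite opprB.
rewrite !innerNr => /(ler_wpM2l g0) h1 h2 h3.
have := mulr_ge0 g0 (mulr_ge0 (ler0n R #|{: Defs.coord S A}|) (enorm_ge0 b)).
by rewrite /eta -/dimc; lra.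
Qed.

(** The variational inequality at [pis] leaves [- inner (q - pi) (q - pi)], which absorbs the cross
    term of [v + U] with [q - pi]. Outside [eta], the noise [U] is thus paired only with [pi - pis],
    a vector known before the noise is drawn. *)
Lemma proj_step_energy :
  inner (q - pis) (q - pis) <= inner (pi - pis) (pi - pis)
    + 2 * g * inner v (pi - pis) + 2 * g * inner U (pi - pis) + eta.
Proof.
have := hvar hpis; have := proj_step_amgm; have := bias_bound hqPi hpis.
have -> : pis - q = - (q - pis) by rewrite opprB.
have -> : q - pis = (q - pi) + (pi - pis) by rewrite addrA subrK.
rewrite /eta !innerNr.
move: (q - pi) (pi - pis) => D a /(ler_wpM2l g0) h1 h2 h3.
rewrite !innerDr !innerDl in h1 h2 h3 *.
rewrite (innerC U v) in h2 *; rewrite (innerC a D).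
have := mulr_ge0 g0 (mulr_ge0 (ler0n R #|{: Defs.coord S A}|) (enorm_ge0 b)).
by rewrite -/dimc; lra.
Qed.

(** A difference of squares is the inner product of [q - pi] with the sum of both deviations, whose
    entries are at most 2 in absolute value; hence the constant, the square of [2 * dimc]. *)
Lemma energy_increment :
  (inner (q - pis) (q - pis) - inner (pi - pis) (pi - pis)) ^+ 2
    <= 4 * dimc ^+ 2 * eta.
Proof.
have e1 : `|inner (q - pis) (q - pis) - inner (pi - pis) (pi - pis)|
    <= 2 * dimc * enorm (q - pi).
  have -> : inner (q - pis) (q - pis) - inner (pi - pis) (pi - pis)
      = inner (q - pi) ((q - pis) + (pi - pis)).
    have -> : q - pis = (q - pi) + (pi - pis) by rewrite addrA subrK.
    by rewrite inner_sqrD !innerDr; ring.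
  have hb x : `|((q - pis) + (pi - pis)) x| <= 2.
    rewrite (_ : 2 = 1 + 1) //; apply: le_trans (ler_normD _ _) _.
    by apply: lerD; exact: Pi_sub_bound.
  rewrite ler_norml inner_le_enorm // andbT lerNl -innerNl.
  apply: le_trans (inner_le_enorm _ hb) _.
  by rewrite {1}/enorm innerNl innerC innerNl opprK.
rewrite -real_normK ?num_real //.
apply: (@le_trans _ _ ((2 * dimc * enorm (q - pi)) ^+ 2)).
  by rewrite ler_pXn2r ?nnegrE // !mulr_ge0 ?enorm_ge0 ?ler0n.
rewrite !exprMn enorm_sqr; have := proj_step_displacement.
by rewrite (_ : 2 ^+ 2 = 4) -?natrX // => h; apply: ler_wpM2l => //;
  rewrite mulr_ge0 ?sqr_ge0.
Qed.

End Step.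

End Geometry.

(** An ultrafilter refining [\oo] converges in every compact segment, so one filter serves all
    coordinates at once. Containing [\oo], it also keeps the eventual properties of the sequence. *)
Lemma seq_cluster (R : realType) (X : Type) (g : nat -> X -> R) :
  (forall n x, 0 <= g n x <= 1) ->
  exists F : set_system nat, ProperFilter F /\ (\oo `<=` F) /\
    exists g0 : X -> R, forall x, g n x @[n --> F] --> g0 x.
Proof.
move=> hg; have [F [FU FS]] := @ultraFilterLemma nat \oo _.
exists F; split; [exact: ultra_proper|split=> //].
suff : forall x, exists p : R, g n x @[n --> F] --> p
  by move=> /choice[g0 hg0]; exists g0.
move=> x.
have := @segment_compact R 0 1 (g ^~ x @ F) _.
case.
  by apply: (@filterE _ F _ (fun n => `[0, 1]%classic (g n x))) => n; rewrite /= in_itv /=; exact: hg.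
move=> p [_ cp]; exists p => B Bp.
have [//|FB] := in_ultra_setVsetC ((g ^~ x) @^-1` B) FU.
have [y [/= y1 y2]] := cp (~` B) B FB Bp.
by case: y1.
Qed.

Section Drift.
Context {R : realType} {N : nat} {S : finType} {A : 'I_N -> finType}.
Variables (r : forall i : 'I_N, S -> joint A -> R)
  (P : S -> S -> joint A -> R) (rho : S -> R).
Hypothesis hP : forall s' s a, 0 <= P s' s a.
Hypothesis hzeta : forall s a, 0 < 1 - \sum_(s' : S) P s' s a.

Lemma Pi_seq_cluster (g : nat -> pol R S A) : (forall n, Pi (g n)) ->
  exists F : set_system nat, ProperFilter F /\ (\oo `<=` F) /\
    exists pi, [/\ Pi pi, forall x, g n x @[n --> F] --> pi x &
      forall x, grad r P rho (g n) x @[n --> F] --> grad r P rho pi x].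
Proof.
move=> hg; have [|F [FF [Foo [pi cpi]]]] := @seq_cluster R (Defs.coord S A) g.
  by move=> n x; exact: Pi_bounds.
exists F; split => //; split => //; exists pi.
have Pipi : Pi pi.
  split=> [x|i s].
    apply: (cvgr_to_ge (cpi x)).
    by apply: filterE => n; have /andP[] := Pi_bounds x (hg n).
  have h : (\sum_(b : A i) g n (crd s b)) @[n --> F] --> \sum_(b : A i) pi (crd s b).
    exact: cvg_sumr.
  apply: (cvg_unique _ h) => //.
  rewrite (_ : (fun n => _) = (fun=> 1)); first exact: cvg_cst.
  by apply/funext => n; have [_ ->] := hg n.
split => // x; apply: grad_cvg => //; exact: filterE.
Qed.

Lemma grad_bounded : exists2 G : R, 0 <= G &
  forall pi, Pi pi -> inner (grad r P rho pi) (grad r P rho pi) <= G.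
Proof.
apply: contrapT => hn.
have /choice[g hg] : forall n : nat, exists pi, Pi pi /\
    n%:R < inner (grad r P rho pi) (grad r P rho pi).
  move=> n; apply: contrapT => hn1; apply: hn; exists n%:R => // pi hpi.
  by rewrite leNgt; apply/negP => h; apply: hn1; exists pi.
have [F [FF [Foo [pi [_ _ cg]]]]] := Pi_seq_cluster (fun n => proj1 (hg n)).
have h : inner (grad r P rho (g n)) (grad r P rho (g n)) @[n --> F]
    --> inner (grad r P rho pi) (grad r P rho pi).
  by apply: cvg_sumr => x _; exact: cvgM.
set l := inner _ _ in h.
have h1 : \forall n \near F, inner (grad r P rho (g n)) (grad r P rho (g n)) < l + 1.
  by apply: (cvgr_lt l h); rewrite ltrDl.
have h2 : \forall n \near F, l + 1 < n%:R.
  by apply: Foo; exact: nbhs_infty_gtr.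
have [n [n1 n2]] := filter_ex (filterI h1 h2).
by have := proj2 (hg n); rewrite ltNge (ltW (lt_trans n1 n2)).
Qed.

(** If no [k] worked, profiles with inner product above [- n.+1%:R^-1] would cluster in the same
    closed annulus. The cluster point differs from [pis] because [0 < e] and lies in the stability
    ball because [R1 < eps ^+ 2], so its inner product is strictly negative, a contradiction. *)
Lemma drift_bound pis (eps : R) : 0 < eps -> Pi pis ->
  (forall pi, Pi pi -> pi != pis -> enorm (pi - pis) < eps ->
      inner (grad r P rho pi) (pi - pis) < 0) ->
  forall e R1 : R, 0 < e -> R1 < eps ^+ 2 -> exists2 k : R, 0 < k &
    forall pi, Pi pi -> e <= inner (pi - pis) (pi - pis) <= R1 ->
      inner (grad r P rho pi) (pi - pis) <= - k.
Proof.
move=> eps0 hpis hst e R1 e0 hR1; apply: contrapT => hn.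
have /choice[g hg] : forall n : nat, exists pi, [/\ Pi pi,
    e <= inner (pi - pis) (pi - pis) <= R1 &
    - n.+1%:R^-1 < inner (grad r P rho pi) (pi - pis)].
  move=> n; apply: contrapT => hn1; apply: hn; exists n.+1%:R^-1.
    by rewrite invr_gt0.
  move=> pi hpi hE; rewrite leNgt; apply/negP => h; apply: hn1; exists pi.
  by split.
have [F [FF [Foo [pi [Pipi cpi cg]]]]] :=
  Pi_seq_cluster (fun n => let: And3 h _ _ := hg n in h).
have cd x : (g n - pis) x @[n --> F] --> (pi - pis) x.
  by apply: cvgB => //; exact: cvg_cst.
have hE : inner (g n - pis) (g n - pis) @[n --> F] --> inner (pi - pis) (pi - pis).
  by apply: cvg_sumr => x _; exact: cvgM.
have hG : inner (grad r P rho (g n)) (g n - pis) @[n --> F]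
   --> inner (grad r P rho pi) (pi - pis).
  by apply: cvg_sumr => x _; exact: cvgM.
have E1 : e <= inner (pi - pis) (pi - pis).
  by apply: (cvgr_to_ge hE); apply: filterE => n; have [_ /andP[]] := hg n.
have E2 : inner (pi - pis) (pi - pis) <= R1.
  by apply: (cvgr_to_le hE); apply: filterE => n; have [_ /andP[]] := hg n.
have neg : inner (grad r P rho pi) (pi - pis) < 0.
  apply: hst => //.
    apply/eqP => pe; move: E1; rewrite pe subrr /inner big1 ?leNgt ?e0 //.
    by move=> x _; rewrite mul0r.
  by rewrite -(@ltr_pXn2r _ 2) ?nnegrE ?enorm_ge0 ?(ltW eps0) // enorm_sqr (le_lt_trans E2).
have h1 := cvgr_lt _ hG _ (_ : _ < inner (grad r P rho pi) (pi - pis) / 2).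
have {}h1 : \forall n \near F, inner (grad r P rho (g n)) (g n - pis) <
    inner (grad r P rho pi) (pi - pis) / 2 by apply: h1; lra.
have h2 : \forall n \near F, n.+1%:R^-1 < - inner (grad r P rho pi) (pi - pis) / 2.
  by apply: Foo; apply: (cvgr_lt 0 cvg_harmonic); lra.
have [n [n1 n2]] := filter_ex (filterI h1 h2).
have [_ _] := hg n.
rewrite ltNge => /negP; apply; rewrite lerNr ltW // (lt_trans n2) //.
by move: n1 => /=; move: (inner _ (g n - pis)) (inner _ (pi - pis)) => X Y; lra.
Qed.

End Drift.

(** * Expectations and conditional expectations *)

Section Expectation.
Context {R : realType} {d} {T : measurableType d} (Pr : probability T R).
Implicit Types (f g h : T -> R) (A B : set T).

Definition Ex f : R := \int[Pr]_w f w.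
Definition L1 f : Prop := Pr.-integrable setT (EFin \o f).
Definition pr A : R := fine (Pr A).

Lemma prE A : measurable A -> Pr A = (pr A)%:E.
Proof. by move=> mA; rewrite /pr fineK // fin_num_measure. Qed.

Lemma pr_ge0 A : 0 <= pr A. Proof. by rewrite /pr fine_ge0. Qed.

Lemma le_pr A B : measurable A -> measurable B -> A `<=` B -> pr A <= pr B.
Proof. by move=> mA mB AB; rewrite -lee_fin -!prE // le_measure ?inE. Qed.

Lemma L1_measurable f : L1 f -> measurable_fun setT f.
Proof. by move/integrableP => [/measurable_EFinP]. Qed.

Lemma L1_bounded f (C : R) : measurable_fun setT f -> (forall w, `|f w| <= C) -> L1 f.
Proof.
move=> mf hf; apply: measurable_bounded_integrable => //.
  by rewrite ltey_eq fin_num_measure.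
exists C; split; first exact: num_real.
by move=> y Cy w _ /=; rewrite (le_trans (hf w)) // ltW.
Qed.

Lemma L1_le f g : measurable_fun setT f -> L1 g -> (forall w, `|f w| <= `|g w|) -> L1 f.
Proof.
move=> mf ig hfg; apply: (le_integrable _ _ _ ig) => //.
  exact/measurable_EFinP.
by move=> w _; rewrite /= lee_fin.
Qed.

Lemma L1_mulr f h (C : R) : L1 f -> measurable_fun setT h ->
  (forall w, `|h w| <= C) -> L1 (fun w => f w * h w).
Proof.
move=> iF mh hh; apply: (L1_le (g := fun w => C * f w)).
- by apply: measurable_funM => //; exact: L1_measurable.
- exact: (@integrableZl _ _ _ Pr _ measurableT C _ iF).
- move=> w; rewrite !normrM mulrC; apply: ler_wpM2r => //.
  by rewrite (le_trans (hh w)) // ler_norm.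
Qed.

Lemma L1_cst (c : R) : L1 (fun=> c).
Proof. by apply: (L1_bounded (C := `|c|)) => //. Qed.

Lemma L1D f g : L1 f -> L1 g -> L1 (fun w => f w + g w).
Proof. by move=> i1 i2; exact: (@integrableD _ _ _ Pr _ measurableT _ _ i1 i2). Qed.

Lemma L1N f : L1 f -> L1 (fun w => - f w).
Proof. by move=> i1; exact: (@integrableN _ _ _ Pr _ _ i1). Qed.

Lemma L1B f g : L1 f -> L1 g -> L1 (fun w => f w - g w).
Proof. by move=> i1 i2; apply: L1D => //; exact: L1N. Qed.

Lemma L1Z (c : R) f : L1 f -> L1 (fun w => c * f w).
Proof. by move=> i1; exact: (@integrableZl _ _ _ Pr _ measurableT c _ i1). Qed.

Lemma L1_sum (I : Type) (s : seq I) (f : I -> T -> R) :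
  (forall i, L1 (f i)) -> L1 (fun w => \sum_(i <- s) f i w).
Proof.
move=> hf; elim: s => [|i s IH].
  by under [X in L1 X]eq_fun do rewrite big_nil; exact: L1_cst.
by under [X in L1 X]eq_fun do rewrite big_cons; exact: L1D.
Qed.

Lemma L1_indic A : measurable A -> L1 (\1_A : T -> R).
Proof. by move=> mA; exact: (integrable_indic Pr mA). Qed.

Lemma ExD f g : L1 f -> L1 g -> Ex (fun w => f w + g w) = Ex f + Ex g.
Proof. by move=> i1 i2; rewrite /Ex RintegralD. Qed.

Lemma ExB f g : L1 f -> L1 g -> Ex (fun w => f w - g w) = Ex f - Ex g.
Proof. by move=> i1 i2; rewrite /Ex RintegralB. Qed.

Lemma ExZ (c : R) f : L1 f -> Ex (fun w => c * f w) = c * Ex f.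
Proof. by move=> i1; rewrite /Ex RintegralZl. Qed.

Lemma Ex_cst (c : R) : Ex (fun=> c) = c.
Proof.
rewrite /Ex Rintegral_cst //; transitivity (c * fine (1%E : \bar R)); last exact: mulr1.
by congr (c * fine _); exact: probability_setT.
Qed.

Lemma Ex_sum (I : Type) (s : seq I) (f : I -> T -> R) :
  (forall i, L1 (f i)) -> Ex (fun w => \sum_(i <- s) f i w) = \sum_(i <- s) Ex (f i).
Proof.
move=> hf; elim: s => [|i s IH].
  by under [X in Ex X]eq_fun do rewrite big_nil; rewrite Ex_cst big_nil.
under [X in Ex X]eq_fun do rewrite big_cons.
by rewrite ExD ?IH ?big_cons //; exact: L1_sum.
Qed.

Lemma le_Ex f g : L1 f -> L1 g -> (forall w, f w <= g w) -> Ex f <= Ex g.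
Proof. by move=> i1 i2 h; apply: le_Rintegral => // w _. Qed.

Lemma Ex_indic A : measurable A -> Ex (\1_A) = pr A.
Proof. by move=> mA; rewrite /Ex /Rintegral integral_indic // setIT. Qed.

Lemma Ex_norm f : L1 f -> `|Ex f| <= Ex (fun w => `|f w|).
Proof. by move=> i1; exact: le_normr_Rintegral. Qed.

Lemma integral_set_indic A f : measurable A -> L1 f ->
  (\int[Pr]_(w in A) (f w)%:E = (Ex (fun w => f w * \1_A w))%:E)%E.
Proof.
move=> mA iF; rewrite integral_mkcond.
have -> : (fun w => (f w)%:E) \_ A = (fun w => (f w * \1_A w)%:E).
  apply/funext => w; rewrite patchE indicE.
  by case: (w \in A); rewrite ?mulr1 ?mulr0.
rewrite /Ex /Rintegral fineK //; apply: integrable_fin_num => //.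
apply: (L1_mulr (C := 1)) => // w.
by rewrite indicE; case: (_ \in _); rewrite ?normr1 ?normr0.
Qed.

End Expectation.

Section LayerCake.
Context {R : realType}.

(** Here [s] is the smaller of [J] and the integer part of [x]; the disjunction separates the
    uncapped from the capped count. *)
Lemma layer_count (x : R) J : 0 <= x ->
  let s := \sum_(j < J) ((j.+1%:R <= x)%R : nat)%:R in
  [/\ s <= J%:R, s <= x & x - 1 <= s \/ s = J%:R :> R].
Proof.
move=> x0; elim: J => [|J [h1 h2 h3]] /=.
  by rewrite big_ord0; split => //; right.
rewrite big_ord_recr /=.
move: h1 h2 h3; set s := (\sum_(_ < _) _) => h1 h2 h3.
rewrite -[J.+1]addn1 natrD; case: (leP (J%:R + 1) x) => hx /=.
  have e : s = J%:R by case: h3 => // h3; apply/eqP; rewrite eq_le h1 /=; lra.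
  by rewrite e; split => //; right.
rewrite addr0; split; [lra|done|left].
by case: h3 => // ->; lra.
Qed.

End LayerCake.

Section ConditionalExpectation.
Context {R : realType} {d} {T : measurableType d} (Pr : probability T R).
Variable gens : set (set T).
Hypothesis hgens : forall E, gens E -> measurable E.
Implicit Types (f g h X Y : T -> R).

(** The preimage condition [Gmeas] read as measurability on the generated sigma-algebra, so that the
    closure lemmas for measurable functions apply. *)
Definition meas_wrt f := measurable_fun (setT : set (g_sigma_algebraType gens))
  (f : g_sigma_algebraType gens -> R).

Lemma sub_measurable E : <<s gens >> E -> measurable E.
Proof.
have : <<s gens >> `<=` @measurable d T.
  by apply: smallest_sub => //; exact: sigma_algebra_measurable.
exact.
Qed.

Lemma meas_wrt_Gmeas f : Gmeas <<s gens >> f <-> meas_wrt f.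
Proof.
split=> [h _ B mB|h B mB]; first by rewrite setTI; exact: h.
by have := h measurableT _ mB; rewrite setTI.
Qed.

Lemma meas_wrt_measurable f : meas_wrt f -> measurable_fun setT f.
Proof.
by move=> h _ B mB; have := h measurableT _ mB; rewrite setTI => /sub_measurable.
Qed.

(* [h] is approximated within [1 / k] by [1 / k \sum_j 1_{h >= j / k}]. *)
Lemma cexp_orthogonal X Y h (C : R) : is_cexp Pr <<s gens >> X Y -> meas_wrt h ->
  (forall w, `|h w| <= C) -> Ex Pr (fun w => (X w - Y w) * h w) = 0.
Proof.
move=> [_ [iX [iY hXY]]] mh hC.
pose Z w := X w - Y w.
have iZ : L1 Pr Z by exact: L1B.
have Z0 E : <<s gens >> E -> Ex Pr (fun w => Z w * \1_E w) = 0.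
  move=> GE; have mE := sub_measurable GE.
  have b1 w : `|\1_E w : R| <= 1 by rewrite indicE; case: (_ \in _); rewrite ?normr1 ?normr0.
  rewrite (_ : (fun w => _) = (fun w => X w * \1_E w - Y w * \1_E w)); last first.
    by apply/funext => w; rewrite mulrBl.
  rewrite ExB; [|by apply: (L1_mulr (C := 1))|by apply: (L1_mulr (C := 1))].
  apply/eqP; rewrite subr_eq0; apply/eqP/EFin_inj.
  by rewrite -!integral_set_indic //; exact: hXY.
have Cpt : 0 <= C := le_trans (normr_ge0 _) (hC point).
pose D := (Num.truncn (2 * C)).+1.
have hD w : 0 <= h w + C <= D%:R.
  have := hC w; rewrite ler_norml => /andP[h1 h2]; apply/andP; split; first lra.
  apply: (@le_trans _ _ (2 * C)); first lra.
  by apply: ltW; apply: truncnS_gt.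
pose hk (k : nat) w : R := \sum_(j < k.+1 * D) \1_[set w | j.+1%:R <= k.+1%:R * (h w + C)] w.
have mE k j : <<s gens >> [set w | j.+1%:R <= k.+1%:R * (h w + C)].
  suff : measurable ([set: g_sigma_algebraType gens] `&`
     [set w | j.+1%:R <= k.+1%:R * (h w + C)]) by rewrite setTI.
  apply: measurable_fun_le => //.
  by apply: measurable_funM => //; apply: measurable_funD.
have b1 E w : `|\1_E w : R| <= 1 by rewrite indicE; case: (_ \in _); rewrite ?normr1 ?normr0.
have mhk k : measurable_fun setT (hk k).
  by apply: measurable_sum => j; apply: measurable_indic; exact: sub_measurable.
have bhk k w : `|k.+1%:R * (h w + C) - hk k w| <= 1.
  have /andP[a1 a2] := hD w.
  have x0 : 0 <= k.+1%:R * (h w + C) by rewrite mulr_ge0.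
  have [] := @layer_count R _ (k.+1 * D) x0.
  have -> : \sum_(j < k.+1 * D) ((j.+1%:R <= k.+1%:R * (h w + C))%R : nat)%:R = hk k w.
    by apply: eq_bigr => j _; rewrite indicE mem_setE.
  rewrite natrM => s1 s2 s3; rewrite ler_norml.
  have le2 : k.+1%:R * (h w + C) <= k.+1%:R * D%:R by apply: ler_wpM2l.
  by case: s3 => s3; apply/andP; split; lra.
have mh' : measurable_fun setT h by exact: meas_wrt_measurable.
have iZh : L1 Pr (fun w => Z w * h w) by exact: L1_mulr iZ mh' hC.
(* [Z] is orthogonal to the indicator of every level set, so after scaling by [k.+1] only the
   slicing error, at most 1, is left. Letting [k] grow then forces the expectation to vanish. *)
have key k : k.+1%:R * `|Ex Pr (fun w => Z w * h w)| <= Ex Pr (fun w => `|Z w|).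
  have iZhk : L1 Pr (fun w => Z w * hk k w).
    apply: (L1_mulr (C := (k.+1 * D)%:R)) => // w.
    apply: le_trans (ler_norm_sum _ _ _) _.
    rewrite -[leRHS](@mulr_natl _ 1) mulr1 -[X in _ <= X%:R](card_ord (k.+1 * D)).
    by rewrite -sumr_const; exact: ler_sum.
  have Zhk0 : Ex Pr (fun w => Z w * hk k w) = 0.
    rewrite (_ : (fun w => _) = (fun w => \sum_(j < k.+1 * D)
       Z w * \1_[set w | j.+1%:R <= k.+1%:R * (h w + C)] w)); last first.
      by apply/funext => w; rewrite mulr_sumr.
    rewrite Ex_sum; first by rewrite big1 // => j _; rewrite Z0.
    by move=> j; apply: (L1_mulr (C := 1)) => //; apply: measurable_indic;
      exact: sub_measurable.
  (* The shift of [h] by [C], made to slice a nonnegative function, is free because [Z] has mean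
     zero. *)
  have ZC0 : Ex Pr (fun w => C * Z w) = 0.
    rewrite ExZ // (_ : Ex Pr Z = 0) ?mulr0 // -(Z0 setT); last first.
      exact: (@measurableT _ (g_sigma_algebraType gens)).
    by congr Ex; apply/funext => w; rewrite indicT mulr1.
  have -> : k.+1%:R * `|Ex Pr (fun w => Z w * h w)|
     = `|Ex Pr (fun w => Z w * (k.+1%:R * (h w + C) - hk k w))|.
    rewrite (_ : (fun w => Z w * (k.+1%:R * (h w + C) - hk k w)) =
      (fun w => k.+1%:R * (Z w * h w + C * Z w) - Z w * hk k w)); last first.
      by apply/funext => w; ring.
    have i1 : L1 Pr (fun w => C * Z w) by exact: L1Z.
    have i2 : L1 Pr (fun w => Z w * h w + C * Z w) by exact: L1D.
    have i3 : L1 Pr (fun w => k.+1%:R * (Z w * h w + C * Z w)) by exact: L1Z.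
    rewrite (ExB i3 iZhk) Zhk0 subr0 (ExZ _ i2) (ExD iZh i1) ZC0 addr0.
    by rewrite normrM ger0_norm.
  have mm : measurable_fun setT (fun w => k.+1%:R * (h w + C) - hk k w).
    by apply: measurable_funB => //; apply: measurable_funM => //;
      apply: measurable_funD.
  apply: le_trans (Ex_norm (L1_mulr iZ mm (bhk k))) _.
  apply: le_Ex; [|exact: integrable_norm|].
    by apply: integrable_norm; exact: L1_mulr iZ mm (bhk k).
  by move=> w; rewrite normrM -[leRHS]mulr1; apply: ler_wpM2l.
apply/eqP; rewrite -normr_eq0; apply/negP => /negP x0.
set x := `|_| in key x0 *.
have xp : 0 < x by rewrite lt_neqAle eq_sym x0 normr_ge0.
have := key (Num.truncn (Ex Pr (fun w => `|Z w|) / x)).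
rewrite -ler_pdivlMr // leNgt => /negP; apply; exact: truncnS_gt.
Qed.

End ConditionalExpectation.

(** * Convergence of a noisy descent *)

Section BoundedMeasurable.
Context {R : realType} {d} {T : measurableType d} (Pr : probability T R).
Implicit Types (f g h : T -> R) (A B : set T).

Definition bmeas f := measurable_fun setT f /\ exists C, forall w, `|f w| <= C.

Lemma bmeas_L1 f : bmeas f -> L1 Pr f.
Proof. by move=> [mf [C hC]]; exact: L1_bounded mf hC. Qed.

Lemma bmeas_cst (c : R) : bmeas (fun=> c).
Proof. by split=> //; exists `|c|. Qed.

Lemma bmeas_indic A : measurable A -> bmeas (\1_A : T -> R).
Proof.
move=> mA; split; first exact: measurable_indic.
by exists 1 => w; rewrite indicE; case: (_ \in _); rewrite ?normr1 ?normr0.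
Qed.

Lemma bmeasD f g : bmeas f -> bmeas g -> bmeas (fun w => f w + g w).
Proof.
move=> [mf [C hC]] [mg [D hD]]; split; first exact: measurable_funD.
by exists (C + D) => w; apply: le_trans (ler_normD _ _) _; exact: lerD.
Qed.

Lemma bmeasM f g : bmeas f -> bmeas g -> bmeas (fun w => f w * g w).
Proof.
move=> [mf [C hC]] [mg [D hD]]; split; first exact: measurable_funM.
by exists (C * D) => w; rewrite normrM; apply: ler_pM.
Qed.

Lemma bmeasB f g : bmeas f -> bmeas g -> bmeas (fun w => f w - g w).
Proof.
move=> [mf [C hC]] [mg [D hD]]; split; first exact: measurable_funB.
by exists (C + D) => w; apply: le_trans (ler_normB _ _) _; exact: lerD.
Qed.

Lemma bmeasX f : bmeas f -> bmeas (fun w => f w ^+ 2).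
Proof. by move=> hf; exact: bmeasM. Qed.

Lemma bmeas_max0 f : bmeas f -> bmeas (fun w => Num.max (f w) 0).
Proof.
move=> [mf [C hC]]; split; first exact: measurable_maxr.
exists C => w; case: (leP (f w) 0) => _ //.
by rewrite normr0 (le_trans (normr_ge0 _) (hC w)).
Qed.

Lemma indic_setI_mul A B w : \1_(A `&` B) w = \1_A w * \1_B w :> R.
Proof. by rewrite !indicE in_setI -natrM mulnb. Qed.

Lemma indic_01 A w : 0 <= (\1_A w : R) <= 1.
Proof. by rewrite indicE; case: (_ \in _); rewrite lexx ler01. Qed.

Lemma pr_setID A B : measurable A -> measurable B ->
  pr Pr A = pr Pr (A `&` B) + pr Pr (A `&` ~` B).
Proof.
move=> mA mB; rewrite -!Ex_indic //; last first.
- exact: measurableI.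
- by apply: measurableI => //; exact: measurableC.
rewrite -ExD; [|apply: L1_indic; exact: measurableI|apply: L1_indic;
  by apply: measurableI => //; exact: measurableC].
congr Ex; apply/funext => w; rewrite !indic_setI_mul -mulrDr !indicE in_setC.
by case: (w \in B); rewrite ?addr0 ?add0r mulr1.
Qed.

End BoundedMeasurable.

Section Descent.
Context {R : realType} {d} {T : measurableType d} (Pr : probability T R).
Variables (gens : nat -> set (set T)) (E : nat -> T -> R) (M R1 s : R)
  (gam e : nat -> R) (kap : R -> R).
Hypotheses (hgens : forall n A, gens n A -> measurable A)
  (hmono : forall n, gens n `<=` gens n.+1)
  (hE : forall n w, 0 <= E n w <= M)
  (mE : forall n, meas_wrt (gens n) (E n))
  (hkap : forall eps, 0 < eps -> 0 < kap eps)
  (hgam : forall n, 0 <= gam n) (he : forall n, 0 <= e n) (R1_gt0 : 0 < R1)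
  (* A conditional inequality in integrated form, tested against weights known at time [n] and
     carried by the basin. Its error is proportional to [pr Pr A], which keeps the final estimate
     relative to the starting event. *)
  (drift : forall n h A C, meas_wrt (gens n) h -> <<s gens n >> A ->
    A `<=` [set w | E n w < R1] -> 0 <= C ->
    (forall w, 0 <= h w <= C * \1_A w) -> forall eps, 0 < eps ->
    Ex Pr (fun w => h w * (E n.+1 w - E n w)) <=
      C * e n * pr Pr A - gam n * kap eps * Ex Pr (fun w => h w * \1_[set w | eps <= E n w] w))
  (increments : forall n A, <<s gens n >> A ->
    Ex Pr (fun w => \1_A w * (E n.+1 w - E n w) ^+ 2) <= e n * pr Pr A)
  (e_sum : forall n, \sum_(0 <= k < n) e k <= s)
  (gam_div : forall N c, exists n, c < \sum_(N <= k < n) gam k).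

Let G n (A : set T) := <<s gens n >> A.

Let GE n A : G n A -> measurable A.
Proof. exact: (sub_measurable (@hgens n)). Qed.

Let GS n A : G n A -> G n.+1 A.
Proof. exact: (sub_sigma_algebra2 (@hmono n)). Qed.

Let GI n A B : G n A -> G n B -> G n (A `&` B).
Proof. exact: (@measurableI _ (g_sigma_algebraType (gens n))). Qed.

Let GU n A B : G n A -> G n B -> G n (A `|` B).
Proof. exact: (@measurableU _ (g_sigma_algebraType (gens n))). Qed.

Let G_ge n c : G n [set w | c <= E n w].
Proof.
suff : measurable ([set: g_sigma_algebraType (gens n)] `&` [set w | c <= E n w]).
  by rewrite setTI.
by apply: measurable_fun_le => //; exact: mE.
Qed.

Let GC n A : G n A -> G n (~` A).
Proof. exact: (@measurableC _ (g_sigma_algebraType (gens n))). Qed.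

Let G_lt n c : G n [set w | E n w < c].
Proof.
rewrite (_ : [set w | _] = ~` [set w | c <= E n w]); first exact: GC.
by apply/seteqP; split => w /=; rewrite ltNge => /negP.
Qed.

Let BE n : bmeas (E n).
Proof.
split; first exact: (meas_wrt_measurable (@hgens n) (@mE n)).
by exists M => w; have /andP[h1 h2] := hE n w; rewrite ger0_norm.
Qed.

Let M_ge0 : 0 <= M.
Proof. by have /andP[h1 h2] := hE 0 point; exact: le_trans h2. Qed.

(* Convex truncated potential: it vanishes up to level [a], so climbing from [a]
   to [b] costs [(b - a)^2], which the summable noise can afford only rarely. *)
Definition phi (a x : R) := Num.max (x - a) 0 ^+ 2.

Lemma phi_ge0 a x : 0 <= phi a x. Proof. exact: sqr_ge0. Qed.

Lemma phi_small a x : x <= a -> phi a x = 0.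
Proof. by rewrite /phi -subr_le0 => /max_idPr ->; rewrite expr0n. Qed.

Lemma phi_large a b x : a <= b -> b <= x -> (b - a) ^+ 2 <= phi a x.
Proof.
move=> ab bx; rewrite /phi.
have /max_idPl -> : 0 <= x - a by lra.
by apply: lerXn2r; rewrite ?nnegrE; lra.
Qed.

(** Second-order expansion: the derivative [2 * Num.max (x - a) 0] of the potential is Lipschitz
    with constant 2. *)
Lemma phi_step a x y :
  phi a y <= phi a x + 2 * Num.max (x - a) 0 * (y - x) + (y - x) ^+ 2.
Proof.
rewrite /phi.
case: (leP (x - a) 0) => hx; case: (leP (y - a) 0) => hy.
- by rewrite mulr0 mul0r expr0n /= !add0r; exact: sqr_ge0.
- by rewrite mulr0 mul0r expr0n /= !add0r; apply: lerXn2r; rewrite ?nnegrE; lra.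
- rewrite expr0n /=; nra.
- nra.
Qed.

Let Bphi a n : bmeas (fun w => phi a (E n w)).
Proof. by apply: bmeasX; apply: bmeas_max0; apply: bmeasB => //; exact: bmeas_cst. Qed.

(** The drift is tested with the slope of [phi a] on [A] as weight, and its favourable part, taken
    at level 1, is discarded. In the constant, [2 * M] bounds the slope and 1 comes from the
    quadratic remainder. *)
Lemma potential_step a n A : 0 <= a -> G n A -> A `<=` [set w | E n w < R1] ->
  Ex Pr (fun w => \1_A w * phi a (E n.+1 w)) <=
  Ex Pr (fun w => \1_A w * phi a (E n w)) + (2 * M + 1) * e n * pr Pr A.
Proof.
move=> a0 GA AR; have mA := GE GA.
have BA := bmeas_indic mA.
pose h w : R := \1_A w * (2 * Num.max (E n w - a) 0).
have Bm : bmeas (fun w => 2 * Num.max (E n w - a) 0).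
  by apply: bmeasM; [exact: bmeas_cst|apply: bmeas_max0; apply: bmeasB => //; exact: bmeas_cst].
have Bh : bmeas h by exact: bmeasM.
have mh : meas_wrt (gens n) h.
  apply: measurable_funM; first exact: measurable_indic.
  apply: measurable_funM => //; apply: measurable_maxr => //.
  by apply: measurable_funB => //; exact: mE.
have hm w : 0 <= 2 * Num.max (E n w - a) 0 <= 2 * M.
  by have /andP[h1 h2] := hE n w; case: (leP (E n w - a) 0) => h3; lra.
have hh w : 0 <= h w <= 2 * M * \1_A w.
  have := indic_01 (R := R) A w; have := hm w; rewrite /h.
  move: (\1_A w) (2 * Num.max _ _) => x y; nra.
have BD : bmeas (fun w => E n.+1 w - E n w) by exact: bmeasB.
have D1 := drift mh GA AR (mulr_ge0 (ler0n R 2) M_ge0) hh ltr01.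
have D2 := increments GA.
have D3 : 0 <= gam n * kap 1 * Ex Pr (fun w => h w * \1_[set w | 1 <= E n w] w).
  apply: mulr_ge0; first exact: mulr_ge0 (hgam n) (ltW (hkap ltr01)).
  apply: Rintegral_ge0 => w _; have /andP[h1 _] := hh w.
  by have /andP[h2 _] := indic_01 (R := R) [set w | 1 <= E n w] w; exact: mulr_ge0.
have B0 : L1 Pr (fun w => \1_A w * phi a (E n.+1 w)) by apply: bmeas_L1; exact: bmeasM.
have B1 : L1 Pr (fun w => \1_A w * phi a (E n w)) by apply: bmeas_L1; exact: bmeasM.
have B2 : L1 Pr (fun w => h w * (E n.+1 w - E n w)) by apply: bmeas_L1; exact: bmeasM.
have B3 : L1 Pr (fun w => \1_A w * (E n.+1 w - E n w) ^+ 2).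
  by apply: bmeas_L1; apply: bmeasM => //; exact: bmeasX.
have B12 := L1D B1 B2.
have D0 : Ex Pr (fun w => \1_A w * phi a (E n.+1 w)) <=
    Ex Pr (fun w => (\1_A w * phi a (E n w) + h w * (E n.+1 w - E n w))
      + \1_A w * (E n.+1 w - E n w) ^+ 2).
  apply: le_Ex => //; first exact: L1D.
  move=> w; rewrite /h -!mulrA -!mulrDr; apply: ler_wpM2l.
    by have /andP[] := indic_01 (R := R) A w.
  by rewrite mulrA; exact: phi_step.
apply: (le_trans D0); rewrite (ExD B12 B3) (ExD B1 B2).
move: D1 D2 D3; lra.
Qed.

(* The [A n] may be re-entered, but only below the level [a], where [phi a] is 0. *)
Lemma crossing_sum (A : nat -> set T) a b p : 0 <= a -> a < b ->
  (forall n, G n (A n)) -> (forall n, A n `<=` [set w | E n w < R1]) ->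
  (forall n, pr Pr (A n) <= p) ->
  (forall n, A n.+1 `&` [set w | a < E n.+1 w] `<=` A n `&` [set w | E n.+1 w < b]) ->
  forall n,
  (b - a) ^+ 2 * \sum_(0 <= k < n) pr Pr (A k `&` [set w | b <= E k.+1 w]) <=
  Ex Pr (fun w => \1_(A 0) w * phi a (E 0 w)) + (2 * M + 1) * s * p.
Proof.
move=> a0 ab GA AR Ap Astep.
have p0 : 0 <= p by apply: le_trans (Ap 0%N); exact: pr_ge0.
suff key n : Ex Pr (fun w => \1_(A n) w * phi a (E n w)) + (b - a) ^+ 2 *
    \sum_(0 <= k < n) pr Pr (A k `&` [set w | b <= E k.+1 w]) <=
    Ex Pr (fun w => \1_(A 0) w * phi a (E 0 w)) +
      (2 * M + 1) * p * \sum_(0 <= k < n) e k.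
  move=> n; have := key n.
  have x0 : 0 <= Ex Pr (fun w => \1_(A n) w * phi a (E n w)).
    by apply: Rintegral_ge0 => w _; rewrite mulr_ge0 ?phi_ge0.
  have x1 : 0 <= (2 * M + 1) * p by rewrite mulr_ge0 // addr_ge0 ?mulr_ge0.
  have := ler_wpM2l x1 (e_sum n); lra.
elim: n => [|n IH]; first by rewrite !big_nil !mulr0 !addr0.
rewrite !big_nat_recr //= !mulrDr.
have mA k : measurable (A k) := GE (GA k).
have mb k : measurable [set w | b <= E k w] := GE (@G_ge k b).
have st := potential_step a0 (GA n) (AR n).
(* Three cases for the new energy: up to [a] the potential is zero; from [b] on, [Astep] excludes
   [A n.+1], so the potential lost pays for the crossing; in between, a path in [A n.+1] was already
   in [A n]. *)
have st2 : Ex Pr (fun w => \1_(A n.+1) w * phi a (E n.+1 w))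
    + (b - a) ^+ 2 * pr Pr (A n `&` [set w | b <= E n.+1 w])
    <= Ex Pr (fun w => \1_(A n) w * phi a (E n.+1 w)).
  rewrite -Ex_indic; last exact: measurableI.
  have i1 : bmeas (fun w => (b - a) ^+ 2 * \1_(A n `&` [set w | b <= E n.+1 w]) w).
    by apply: bmeasM; [exact: bmeas_cst|apply: bmeas_indic; exact: measurableI].
  have i2 : bmeas (fun w => \1_(A n.+1) w * phi a (E n.+1 w)).
    by apply: bmeasM => //; exact: bmeas_indic.
  rewrite -ExZ; last by apply: L1_indic; exact: measurableI.
  rewrite -ExD; [|exact: bmeas_L1|exact: bmeas_L1].
  apply: le_Ex.
  - by apply: bmeas_L1; exact: bmeasD.
  - by apply: bmeas_L1; apply: bmeasM => //; exact: bmeas_indic.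
  - move=> w; rewrite indic_setI_mul.
    have [ha|ha] := leP (E n.+1 w) a.
      rewrite phi_small // !mulr0 add0r [\1_[set _ | _] w]indicE memNset.
        by rewrite !mulr0.
      by move=> /=; rewrite leNgt (le_lt_trans ha).
    have ph := phi_ge0 a (E n.+1 w).
    have /andP[An0 An1] := indic_01 (R := R) (A n) w.
    have [hb|hb] := leP b (E n.+1 w).
      rewrite [\1_(A n.+1) w]indicE memNset ?mul0r ?add0r; last first.
        by move=> hA; have [_ /=] := Astep n w (conj hA ha); rewrite ltNge hb.
      rewrite [\1_[set _ | _] w]indicE mem_set // mulr1 mulrC.
      by apply: ler_wpM2l => //; apply: phi_large => //; exact: ltW.
    rewrite [\1_[set _ | _] w]indicE memNset ?mulr0 ?addr0; last first.
      by move=> /=; rewrite leNgt hb.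
    apply: ler_wpM2r => //.
    have [hA|hA] := pselect (A n.+1 w).
      by have [h1 _] := Astep n w (conj hA ha); rewrite !indicE !mem_set.
    by rewrite indicE memNset.
have x1 : 0 <= 2 * M + 1 by rewrite addr_ge0 ?mulr_ge0.
have := ler_wpM2l (mulr_ge0 x1 (he n)) (Ap n); lra.
Qed.


(** Only countable quantifiers remain on the right, so the event of convergence becomes visibly
    measurable. *)
Lemma cvg0_harmonicP (u : nat -> R) : (forall n, 0 <= u n) ->
  (u @ \oo --> (0 : R)) <-> (forall j, exists N, forall n, u (N + n)%N < j.+1%:R^-1).
Proof.
move=> u0; split=> [cu j|hu].
  have : \forall n \near \oo, u n < j.+1%:R^-1.
    by apply: (cvgr_lt 0 cu); rewrite invr_gt0.
  by move=> [N _ hN]; exists N => n; apply: hN => /=; rewrite leq_addr.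
apply/cvgr0Pnorm_lt => eps eps0.
have [j _ hj] := near_infty_natSinv_lt (PosNum eps0).
have [N hN] := hu j; exists N => // n /= Nn.
rewrite ger0_norm // -(subnKC Nn); apply: lt_trans (hN _) _.
by apply: hj => /=.
Qed.

(** * Probability of never leaving the basin *)

Let U := [set w | E 0 w < R1 / 4].

Fixpoint survive (n : nat) : set T :=
  if n is m.+1 then survive m `&` [set w | E m.+1 w < R1] else U.

Let survive_G n : G n (survive n).
Proof.
elim: n => [|n IH] /=; first exact: G_lt.
by apply: GI; [exact: GS|exact: G_lt].
Qed.

Let survive_lt n : survive n `<=` [set w | E n w < R1].
Proof.
case: n => [|n] w /=; last by case.
by move=> /= h; apply: (lt_trans h); have := R1_gt0; lra.
Qed.

Let survive_U n : survive n `<=` U.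
Proof. by elim: n => [|n IH] w //= [/IH]. Qed.

Let mU : measurable U. Proof. exact: (GE (@survive_G 0%N)). Qed.
Let msurvive n : measurable (survive n) := GE (@survive_G n).

Let surviveS n : survive n.+1 `<=` survive n.
Proof. by move=> w []. Qed.

(** The mass lost up to time [n] is a sum of exit probabilities, which [crossing_sum] bounds with
    levels [R1 / 4] and [R1] and with [p = pr Pr U]; its initial term is zero on [U]. *)
Lemma survive_pr n :
  (R1 - R1 / 4) ^+ 2 * (pr Pr U - pr Pr (survive n)) <= (2 * M + 1) * s * pr Pr U.
Proof.
have -> : pr Pr U - pr Pr (survive n) =
    \sum_(0 <= k < n) pr Pr (survive k `&` [set w | R1 <= E k.+1 w]).
  elim: n => [|n IH]; first by rewrite big_nil subrr.
  rewrite big_nat_recr //= -IH.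
  rewrite (pr_setID Pr (msurvive n) (GE (@G_ge n.+1 R1))).
  rewrite (_ : ~` [set w | R1 <= E n.+1 w] = [set w | E n.+1 w < R1]); first ring.
  by apply/seteqP; split => w /=; rewrite ltNge => /negP.
have := @crossing_sum survive (R1 / 4) R1 (pr Pr U) _ _ survive_G survive_lt _ _ n.
rewrite (_ : Ex Pr _ = 0) ?add0r; last first.
  rewrite -[RHS](Ex_cst Pr 0); congr Ex; apply/funext => w.
  rewrite indicE; case: (boolP (w \in survive 0)) => [/set_mem /= hw|_]; last by rewrite mul0r.
  by rewrite phi_small ?mulr0 // ltW.
have := R1_gt0; move=> r0; apply; [lra|lra| |].
- by move=> k; apply: le_pr => //; exact: survive_U.
- by move=> k w [[h1 h2] _].
Qed.

Let forever := \bigcap_n survive n.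

Let mforever : measurable forever.
Proof. exact: bigcap_measurable. Qed.

Lemma forever_pr delta : (2 * M + 1) * s <= delta * (R1 - R1 / 4) ^+ 2 ->
  (1 - delta) * pr Pr U <= pr Pr forever.
Proof.
move=> hd.
have cv : Pr \o survive @ \oo --> Pr forever.
  apply: nonincreasing_cvg_mu => //.
    by rewrite ltey_eq fin_num_measure.
  by apply/nonincreasing_seqP => n; apply/subsetPset; exact: surviveS.
rewrite -lee_fin -(prE Pr mforever) -(cvg_lim _ cv) //.
apply: lime_ge; first exact: cvgP cv.
apply: nearW => n /=; rewrite (prE Pr (msurvive n)) lee_fin.
have := survive_pr n; have := pr_ge0 Pr U.
have c0 : 0 < (R1 - R1 / 4) ^+ 2 by apply: exprn_gt0; have := R1_gt0; lra.
move=> p0 h; have h2 := ler_wpM2r p0 hd.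
have : (R1 - R1 / 4) ^+ 2 * (pr Pr U - pr Pr (survive n)) <=
  (R1 - R1 / 4) ^+ 2 * (delta * pr Pr U) by lra.
rewrite ler_pM2l //; lra.
Qed.

(** * Survivors come close to the equilibrium infinitely often *)

Let stuck eps N := forever `&` \bigcap_n [set w | eps <= E (N + n)%N w].

Let mstuck eps N : measurable (stuck eps N).
Proof.
by apply: measurableI => //; apply: bigcap_measurable => // n _; exact: GE (@G_ge _ _).
Qed.

(** The drift is tested with the indicator of survival and summed: the energy lies between 0 and [M]
    and the noise adds at most [s], so the accumulated decrease is bounded. *)
Lemma drift_sum eps n : 0 < eps ->
  kap eps * \sum_(0 <= k < n) gam k * pr Pr (survive k `&` [set w | eps <= E k w])
    <= M + s.
Proof.
move=> eps0.
have BI k : bmeas (fun w => \1_(survive k) w * E k w).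
  by apply: bmeasM => //; exact: bmeas_indic.
suff key : Ex Pr (fun w => \1_(survive n) w * E n w) +
   kap eps * \sum_(0 <= k < n) gam k * pr Pr (survive k `&` [set w | eps <= E k w])
   <= Ex Pr (fun w => \1_(survive 0) w * E 0 w) + \sum_(0 <= k < n) e k.
  have h1 : 0 <= Ex Pr (fun w => \1_(survive n) w * E n w).
    by apply: Rintegral_ge0 => w _; rewrite mulr_ge0 //; have /andP[] := hE n w.
  have h2 : Ex Pr (fun w => \1_(survive 0) w * E 0 w) <= M.
    rewrite -[leRHS](Ex_cst Pr M); apply: le_Ex; [exact: bmeas_L1|exact: L1_cst|].
    move=> w; have /andP[a1 a2] := hE 0 w.
    by have /andP[b1 b2] := indic_01 (R := R) (survive 0) w; nra.
  have := e_sum n; lra.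
elim: n => [|n IH]; first by rewrite !big_nil mulr0 !addr0.
rewrite !big_nat_recr //= mulrDr.
have Bs : bmeas (\1_(survive n) : T -> R) by exact: bmeas_indic.
have st : Ex Pr (fun w => \1_(survive n.+1) w * E n.+1 w) <=
    Ex Pr (fun w => \1_(survive n) w * E n w)
    + Ex Pr (fun w => \1_(survive n) w * (E n.+1 w - E n w)).
  have B2 : bmeas (fun w => \1_(survive n) w * (E n.+1 w - E n w)).
    by apply: bmeasM => //; exact: bmeasB.
  rewrite -ExD; [|exact: bmeas_L1|exact: bmeas_L1].
  apply: le_Ex; [exact: bmeas_L1|by apply: bmeas_L1; exact: bmeasD|].
  move=> w; rewrite -mulrDr addrCA subrr addr0.
  apply: ler_wpM2r; first by have /andP[] := hE n.+1 w.
  rewrite indic_setI_mul -[leRHS]mulr1; exact: ler_wpM2l.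
have ms : meas_wrt (gens n) (\1_(survive n) : T -> R).
  have mSn : measurable (survive n : set (g_sigma_algebraType (gens n))) := @survive_G n.
  have := @measurable_indic _ (g_sigma_algebraType (gens n)) R setT (survive n) mSn.
  exact.
have h1 w : 0 <= (\1_(survive n) w : R) <= 1 * \1_(survive n) w.
  by rewrite mul1r lexx andbT; have /andP[] := indic_01 (R := R) (survive n) w.
have := drift ms (@survive_G n) (@survive_lt n) ler01 h1 eps0.
have -> : (fun w => \1_(survive n) w * \1_[set w0 | eps <= E n w0] w) =
    \1_(survive n `&` [set w | eps <= E n w]) :> (T -> R).
  by apply/funext => w; rewrite indic_setI_mul.
rewrite Ex_indic; last by apply: measurableI => //; exact: GE (@G_ge _ _).
have p1 : pr Pr (survive n) <= 1.
  by rewrite -lee_fin -(prE Pr (msurvive n)) probability_le1.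
have := ler_wpM2l (he n) p1; lra.
Qed.

(** If the event had probability [q > 0], each step [k] from [N] on would contribute at least
    [gam k * q] to the bounded sum in [drift_sum], against the divergence of the step sizes. *)
Lemma stuck_pr eps N : 0 < eps -> Pr (stuck eps N) = 0%E.
Proof.
move=> eps0; rewrite prE //; congr (_%:E).
apply/eqP; rewrite eq_le pr_ge0 andbT leNgt; apply/negP => p0.
set q := pr Pr _ in p0.
have kq : 0 < kap eps * q by apply: mulr_gt0 => //; exact: hkap.
have [n] := gam_div N ((M + s) / (kap eps * q)).
rewrite ltr_pdivrMr // ltNge => /negP; apply.
have := drift_sum n eps0; apply: le_trans.
rewrite mulrCA; apply: ler_wpM2l; first exact: ltW (hkap eps0).
have t0 k : 0 <= gam k * pr Pr (survive k `&` [set w | eps <= E k w]).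
  by rewrite mulr_ge0 // pr_ge0.
apply: (@le_trans _ _ (\sum_(N <= k < n)
    gam k * pr Pr (survive k `&` [set w | eps <= E k w]))).
  rewrite mulr_suml; apply: ler_sum_nat => k /andP[Nk _].
  apply: ler_wpM2l => //; apply: le_pr => //.
    by apply: measurableI => //; exact: GE (@G_ge _ _).
  move=> w [hw hk]; split; first exact: hw.
  by have := hk (k - N)%N I; rewrite /= subnKC.
have [Nn|nN] := leqP N n.
  by rewrite [leRHS](big_cat_nat _ Nn) //= lerDr sumr_ge0.
by rewrite big_geq ?sumr_ge0 // ltnW.
Qed.

(* A path is active from a visit below [eps] until it reaches [4 * eps]. *)
Fixpoint active (eps : R) (n : nat) : set T :=
  survive n `&` (if n is m.+1
    then [set w | E n w < eps] `|` (active eps m `&` [set w | E n w < 4 * eps])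
    else [set w | E n w < eps]).

Let active_G eps n : G n (active eps n).
Proof.
elim: n => [|n IH] /=; apply: GI; [exact: G_lt|exact: G_lt|exact: (@survive_G n.+1)|].
by apply: GU; [exact: G_lt|apply: GI; [exact: GS|exact: G_lt]].
Qed.

Let active_survive eps n : active eps n `<=` survive n.
Proof. by case: n => [|n] w []. Qed.

Let escape eps k := active eps k `&` [set w | 4 * eps <= E k.+1 w].

Let mescape eps k : measurable (escape eps k).
Proof. by apply: measurableI; [exact: GE (@active_G _ _)|exact: GE (@G_ge _ _)]. Qed.

(** [crossing_sum] with [p = 1] makes the escape probabilities summable, and the first
    Borel-Cantelli lemma applies. Unlike for survival, the initial potential need not vanish; being
    finite is enough. *)
Lemma escape_io eps : 0 < eps -> Pr (lim_sup_set (escape eps)) = 0%E.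
Proof.
move=> eps0; apply: lim_sup_set_cvg0 => //.
have hb := @crossing_sum (active eps) eps (4 * eps) 1 (ltW eps0) _
  (active_G eps) _ _ _.
set X := Ex _ _ + _ in hb.
have {}hb n : (4 * eps - eps) ^+ 2 * \sum_(0 <= k < n) pr Pr (escape eps k) <= X.
  apply: hb; [lra| | |].
  - by move=> k w /active_survive /survive_lt.
  - move=> k; have mk := GE (@active_G eps k); by rewrite -lee_fin -(prE Pr mk) probability_le1.
  - move=> k w [[_ /=]]; case=> [|[h1 h2] h3]; first by move=> h1; rewrite ltNge ltW.
    by split.
have c0 : 0 < (4 * eps - eps) ^+ 2 by apply: exprn_gt0; lra.
apply: (@le_lt_trans _ _ (X / (4 * eps - eps) ^+ 2)%:E); last exact: ltry.
apply: lime_le; first exact: is_cvg_nneseries.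
apply: nearW => n.
rewrite (eq_bigr (fun k => (pr Pr (escape eps k))%:E)); last by move=> k _; rewrite -prE.
by rewrite sumEFin lee_fin ler_pdivlMr // mulrC.
Qed.

Lemma descent_convergence delta : (2 * M + 1) * s <= delta * (R1 - R1 / 4) ^+ 2 ->
  ((1 - delta)%:E * Pr U <=
    Pr [set w | U w /\ ((fun n => E n w) @ \oo --> (0 : R))%R])%E.
Proof.
move=> hd; rewrite (prE Pr mU) -EFinM.
pose ej (j : nat) : R := j.+1%:R^-1.
have ej0 j : 0 < ej j by rewrite invr_gt0.
pose Z := \bigcup_j ((\bigcup_N stuck (ej j) N) `|` lim_sup_set (escape (ej j))).
set V := [set w | _].
have mV : measurable V.
  rewrite (_ : V = U `&` \bigcap_j \bigcup_N \bigcap_n [set w | E (N + n)%N w < ej j]).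
    apply: measurableI => //; apply: bigcap_measurable => // j _.
    apply: bigcup_measurable => N _; apply: bigcap_measurable => // n _.
    exact: GE (@G_lt _ _).
  apply/seteqP; split => w.
    move=> [h1 h2]; split => // j _.
    have [N hN] := (cvg0_harmonicP (fun n => proj1 (andP (hE n w)))).1 h2 j.
    by exists N => // n _; exact: hN.
  move=> [h1 h2]; split => //.
  apply/(cvg0_harmonicP (fun n => proj1 (andP (hE n w)))) => j.
  by have [N _ hN] := h2 j I; exists N => n; exact: hN.
have Z0 : Pr.-negligible Z.
  apply: negligible_bigcup => j; apply: negligibleU.
    apply: negligible_bigcup => N; exists (stuck (ej j) N); split => //.
    exact: stuck_pr.
  exists (lim_sup_set (escape (ej j))); split => //; last exact: escape_io.
  by apply: bigcap_measurable => // n _; apply: bigcup_measurable => k _.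
have sub : forever `<=` V `|` Z.
  move=> w hw; have [|hZ] := pselect (Z w); [by right|left].
  split; first exact: (hw 0%N I).
  apply/(cvg0_harmonicP (fun n => proj1 (andP (hE n w)))) => i.
  (* An active path is only known to be below four times its level, hence a level at least four
     times finer than the target. *)
  pose j := (4 * i.+1)%N.
  have ji : 4 * ej j <= i.+1%:R^-1.
    rewrite /ej /j -ler_pdivlMl // -invfM lef_pV2 ?posrE ?mulr_gt0 //.
    by rewrite -natrM ler_nat.
  have [N0 hN0] : exists N0, forall k, (N0 <= k)%N -> ~ escape (ej j) k w.
    apply: contrapT => hn; apply: hZ; exists j => //; right => N _.
    apply: contrapT => hn2; apply: hn; exists N => k Nk hk; apply: hn2.
    by exists k.
  have [n hn] : exists n, E (N0 + n)%N w < ej j.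
    apply: contrapT => hn; apply: hZ; exists j => //; left; exists N0 => //.
    split => // n _ /=; rewrite leNgt; apply/negP => h; apply: hn; by exists n.
  (* [N0] is beyond the last escape, and the path is below the level at time [N0 + n]. A path of
     [forever] can stop being active only by an escape, so it stays active. *)
  have act m : active (ej j) (N0 + n + m)%N w.
    elim: m => [|m IH].
      rewrite addn0; case: (N0 + n)%N hn => [|k] hk; split; try exact: hw.
        exact: hk.
      by left.
    rewrite addnS; split; first exact: (hw (N0 + n + m).+1 I).
    right; split => //=; rewrite ltNge; apply/negP => h.
    by apply: (hN0 (N0 + n + m)%N) => //; rewrite -addnA leq_addr.
  exists (N0 + n)%N => m; apply: lt_le_trans ji.
  have := act m; case: (N0 + n + m)%N => [|k] [_] /=.
    by move=> h; rewrite (lt_trans h) // ltr_pMl // ltr1n.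
  by case=> [h|[]//]; rewrite (lt_trans h) // ltr_pMl // ltr1n.
have [Z' [mZ' Z'0 ZZ']] := Z0.
apply: (@le_trans _ _ (Pr forever)).
  by rewrite (prE Pr mforever) lee_fin; exact: forever_pr.
apply: (@le_trans _ _ (Pr (V `|` Z'))).
  apply: le_measure; rewrite ?inE //; first exact: measurableU.
  by move=> w /sub [|/ZZ']; [left|right].
by rewrite measureU0.
Qed.

End Descent.

(** * Step sizes *)

Section StepSizes.
Context {R : realType}.

(* From [(1 - 1/x)^(-c) >= exp (c / x) >= 1 + c / x]. *)
Lemma powRN_telescope (c : R) n : 0 < c ->
  c * n.+2%:R `^ (- (c + 1)) <= n.+1%:R `^ (- c) - n.+2%:R `^ (- c).
Proof.
move=> c0; set x := (n.+2%:R : R).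
have x0 : 0 < x by rewrite ltr0n.
have y0 : 0 < x^-1 by rewrite invr_gt0.
have y1 : x^-1 < 1 by rewrite invf_lt1 // ltr1n.
have e1 : (n.+1%:R : R) = x * (1 - x^-1).
  by rewrite mulrBr mulr1 divff ?gt_eqF // /x -[n.+2]addn1 natrD addrK.
clearbody x.
have le1 : 1 + c * x^-1 <= (1 - x^-1) `^ (- c).
  rewrite /powR gt_eqF ?subr_gt0 //.
  apply: (@le_trans _ _ (expR (c * x^-1))); first exact: expR_ge1Dx.
  rewrite ler_expR mulNr -mulrN; apply: ler_wpM2l; first exact: ltW.
  by rewrite lerNr; apply: le_ln1Dx; rewrite ltrN2.
rewrite e1 powRM ?(ltW x0) ?subr_ge0 ?(ltW y1) //.
have -> : x `^ (- (c + 1)) = x `^ (- c) * x^-1.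
  by rewrite opprD powRD ?powR_inv1 ?(ltW x0) //; apply/implyP => _; rewrite gt_eqF.
have := ler_wpM2l (powR_ge0 x (- c)) le1.
move: (x `^ (- c)) (x^-1) (_ `^ _) => t1 t2 t3; lra.
Qed.

(** With [c = a - 1], adding the last base to the power [- c] to [c] times the partial sum gives a
    quantity that never increases, by [powRN_telescope], and that starts at [c + 1]. *)
Lemma p_series_bounded (a : R) : 1 < a ->
  exists C, forall n, \sum_(0 <= k < n) k.+1%:R `^ (- a) <= C.
Proof.
move=> a1; pose c := a - 1; have c0 : 0 < c by rewrite subr_gt0.
have ac : - a = - (c + 1) by rewrite /c subrK.
have key n : c * \sum_(0 <= k < n.+1) k.+1%:R `^ (- a) + n.+1%:R `^ (- c) <= c + 1.
  elim: n => [|n IH]; first by rewrite big_nat1 !powR1 mulr1.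
  rewrite big_nat_recr //= mulrDr.
  have := powRN_telescope n c0; rewrite -ac; lra.
exists ((c + 1) / c) => n.
rewrite ler_pdivlMr // mulrC.
apply: (@le_trans _ _ (c * \sum_(0 <= k < n.+1) k.+1%:R `^ (- a))).
  apply: ler_wpM2l; first exact: ltW.
  by rewrite big_nat_recr //= lerDl powR_ge0.
have := key n; have := powR_ge0 (n.+1%:R : R) (- c); lra.
Qed.

Definition sum_bounded (u : nat -> R) := exists C, forall n, \sum_(0 <= k < n) u k <= C.

Lemma sum_bounded_shift (u : nat -> R) n0 : (forall n, 0 <= u n) ->
  (exists C, forall n, \sum_(n0 <= k < n0 + n) u k <= C) -> sum_bounded u.
Proof.
move=> u0 [C hC]; exists (\sum_(0 <= k < n0) u k + C) => n.
apply: (@le_trans _ _ (\sum_(0 <= k < n0 + n) u k)).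
  rewrite [leRHS](@big_cat_nat _ _ _ n) //= ?leq_addl //.
  by rewrite lerDl sumr_ge0.
by rewrite (@big_cat_nat _ _ _ n0) //= ?leq_addr // lerD2l.
Qed.

Lemma sum_bounded_powR (u : nat -> R) (a C : R) n0 : 1 < a -> (forall n, 0 <= u n) ->
  (forall n, (n0 <= n)%N -> u n <= C * n.+1%:R `^ (- a)) -> sum_bounded u.
Proof.
move=> a1 u0 hu; have [D hD] := p_series_bounded a1.
apply: (@sum_bounded_shift u n0) => //; exists (`|C| * D) => n.
apply: (@le_trans _ _ (\sum_(n0 <= k < n0 + n) `|C| * k.+1%:R `^ (- a))).
  apply: ler_sum_nat => k /andP[hk _]; apply: le_trans (hu k hk) _.
  by apply: ler_wpM2r; [exact: powR_ge0|exact: ler_norm].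
rewrite -mulr_sumr; apply: ler_wpM2l => //; apply: le_trans (hD (n0 + n)%N).
rewrite [leRHS](@big_cat_nat _ _ _ n0) //= ?leq_addr // lerDr.
by apply: sumr_ge0 => k _; exact: powR_ge0.
Qed.

Lemma sum_bounded_tail (u : nat -> R) : (forall n, 0 <= u n) -> sum_bounded u ->
  forall tol, 0 < tol -> exists N, forall n, \sum_(N <= k < n) u k <= tol.
Proof.
move=> u0 [C hC] tol tol0.
have cu : cvgn (series u).
  apply: nondecreasing_is_cvgn.
    by apply/nondecreasing_seqP => n; rewrite /series /= big_nat_recr //= lerDl.
  by exists C => _ [n _ <-]; exact: hC.
have ub n : series u n <= limn (series u).
  apply: nondecreasing_cvgn_le => //.
  by apply/nondecreasing_seqP => k; rewrite /series /= big_nat_recr //= lerDl.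
have : \forall n \near \oo, limn (series u) - tol < series u n.
  by apply: (cvgr_gt _ cu); rewrite ltrBlDr ltrDl.
move=> [N _ hN]; exists N => n.
have [nN|Nn] := leqP n N; first by rewrite big_geq // ltW.
have := hN N (leqnn N); have := ub n; rewrite /series /=.
by rewrite [X in X <= _](@big_cat_nat _ _ _ N) //= ?(ltnW Nn) //; lra.
Qed.

Variables (p lb ls : R) (hp : 1 / 2 < p <= 1) (hplb : 1 < p + lb)
  (hpls : 1 / 2 < p - ls).
Variables (Bb sig : nat -> R).
Hypotheses (hB0 : forall n, 0 <= Bb n) (hsig0 : forall n, 0 <= sig n)
  (hBO : exists C n0, forall n, (n0 <= n)%N -> Bb n <= C * (n%:R `^ (- lb)))
  (hsigO : exists C n0, forall n, (n0 <= n)%N -> sig n <= C * (n%:R `^ ls)).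

Definition step (gamma m : R) (n : nat) := gamma / (n%:R + m) `^ p.

(** The form of the bound on the conditional mean of one step's noise term: [c1] will carry the
    gradient bound and [c3] the size of the polytope. The index is [k.+1] because the template
    starts at 1. *)
Definition noise_budget (c1 c2 c3 gamma m : R) (k : nat) :=
  step gamma m k.+1 ^+ 2 * (c1 + c2 * sig k.+1 ^+ 2)
  + c3 * step gamma m k.+1 * Bb k.+1.

Let p0 : 0 < p. Proof. by have := hp; lra. Qed.

Lemma step_ge0 gamma m n : 0 <= gamma -> 0 <= step gamma m n.
Proof. by move=> h; rewrite divr_ge0 // powR_ge0. Qed.

Lemma step_le gamma m n : 0 <= gamma -> 0 <= m ->
  step gamma m n.+1 <= gamma * n.+1%:R `^ (- p).
Proof.
move=> g0 m0; rewrite powRN; apply: ler_wpM2l => //.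
rewrite lef_pV2 ?posrE ?powR_gt0 ?ltr_wpDr ?ltr0n //.
apply: ge0_ler_powR; [exact: ltW p0|by rewrite nnegrE|by rewrite nnegrE addr_ge0|].
by rewrite lerDl.
Qed.

Lemma step_le_shift gamma m n : 0 <= gamma -> 0 < m ->
  step gamma m n.+1 <= gamma * (m `^ p)^-1.
Proof.
move=> g0 m0; apply: ler_wpM2l => //.
have hm : 0 < n.+1%:R + m by rewrite ltr_wpDl.
rewrite lef_pV2 ?posrE ?powR_gt0 //.
apply: ge0_ler_powR; [exact: ltW p0|by rewrite nnegrE ltW|by rewrite nnegrE ltW|].
by rewrite lerDr.
Qed.

(** Since [p <= 1], the denominator is at most [k.+1%:R + m], hence at most [(1 + m) * k.+1%:R], and
    the harmonic series diverges. *)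
Lemma step_divergence gamma m : 0 < gamma -> 0 <= m ->
  forall N c, exists n, c < \sum_(N <= k < n) step gamma m k.+1.
Proof.
move=> g0 m0 N c; apply: contrapT => hn.
have {}hn n : \sum_(N <= k < n) step gamma m k.+1 <= c.
  by rewrite leNgt; apply/negP => h; apply: hn; exists n.
have lo k : gamma / (1 + m) * harmonic k <= step gamma m k.+1.
  rewrite /step -mulrA; apply: ler_wpM2l; first exact: ltW.
  have h1 : 0 < 1 + m by rewrite ltr_pwDl.
  have h2 : 0 < k.+1%:R + m by rewrite ltr_pwDl.
  rewrite -invfM lef_pV2 ?posrE ?powR_gt0 ?mulr_gt0 //.
  apply: (@le_trans _ _ (k.+1%:R + m)).
    rewrite -[leRHS]powRr1 ?(ltW h2) //; apply: ler_powR; last by case/andP: hp.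
    by rewrite -natr1 -addrA addrCA lerDl addr_ge0.
  rewrite mulrDl mul1r lerD2l ler_peMr // ler1n //.
apply: (@dvg_harmonic R); apply: nondecreasing_is_cvgn.
  by apply/nondecreasing_seqP => n; rewrite /series /= big_nat_recr //= lerDl harmonic_ge0.
have gm : 0 < gamma / (1 + m) by rewrite divr_gt0 // ltr_pwDl.
suff [C hC] : sum_bounded harmonic by exists C => _ [n _ <-]; exact: hC.
apply: (@sum_bounded_shift _ N); first exact: harmonic_ge0.
exists (c / (gamma / (1 + m))) => n.
rewrite ler_pdivlMr // mulrC mulr_sumr; apply: le_trans (hn (N + n)%N).
by apply: ler_sum => k _; exact: lo.
Qed.

Variables (c1 c2 c3 : R) (hc1 : 0 <= c1) (hc2 : 0 <= c2) (hc3 : 0 <= c3).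

Let bA k : R := (k.+1%:R `^ (- p)) ^+ 2 * (c1 + c2 * sig k.+1 ^+ 2).
Let bB k : R := c3 * k.+1%:R `^ (- p) * Bb k.+1.

Let bA0 k : 0 <= bA k.
Proof. by rewrite mulr_ge0 ?sqr_ge0 // addr_ge0 // mulr_ge0 // sqr_ge0. Qed.

Let bB0 k : 0 <= bB k.
Proof. by rewrite !mulr_ge0 ?powR_ge0. Qed.

Let powRX2 k (x : R) : (k.+1%:R `^ x) ^+ 2 = k.+1%:R `^ (2 * x) :> R.
Proof. by rewrite -powR_mulrn ?powR_ge0 // -powRrM mulrC. Qed.

Let powRDk k (x y : R) : k.+1%:R `^ (x + y) = k.+1%:R `^ x * k.+1%:R `^ y :> R.
Proof. by rewrite powRD //; apply/implyP => _; rewrite pnatr_eq0. Qed.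

(** The decay exponents are [2 * p] for the gradient part and [2 * (p - ls)] for the noise part,
    both above 1. *)
Let bA_sum : sum_bounded bA.
Proof.
have [C [n0 hC]] := hsigO.
pose q1 k : R := c1 * k.+1%:R `^ (- (2 * p)).
pose q2 k : R := (k.+1%:R `^ (- p)) ^+ 2 * (c2 * sig k.+1 ^+ 2).
have [C1 h1] : sum_bounded q1.
  apply: (@sum_bounded_powR _ (2 * p) c1 0%N) => //; first by have := hp; lra.
  by move=> n; rewrite mulr_ge0 ?powR_ge0.
have [C2 h2] : sum_bounded q2.
  apply: (@sum_bounded_powR _ (2 * (p - ls)) (c2 * C ^+ 2) n0).
  - by have := hpls; lra.
  - by move=> n; rewrite mulr_ge0 ?sqr_ge0 // mulr_ge0 // sqr_ge0.
  - move=> n hn; rewrite /q2.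
    have hs : sig n.+1 ^+ 2 <= (C * n.+1%:R `^ ls) ^+ 2.
      by apply: lerXn2r; rewrite ?nnegrE // ?(le_trans (hsig0 _) (hC n.+1 _)) ?hC // ltnW.
    have -> : - (2 * (p - ls)) = 2 * - p + 2 * ls by ring.
    rewrite powRDk -!powRX2 -mulrA [leLHS]mulrCA; apply: ler_wpM2l => //.
    rewrite [leRHS]mulrCA -[C ^+ 2 * _]exprMn; apply: ler_wpM2l => //.
exists (C1 + C2) => n; apply: le_trans (lerD (h1 n) (h2 n)).
rewrite -big_split /=; apply: ler_sum => k _.
rewrite /bA /q1 /q2 mulrDr lerD2r powRX2 mulrC.
by have -> : - (2 * p) = 2 * - p by ring.
Qed.

Let bB_sum : sum_bounded bB.
Proof.
have [C [n0 hC]] := hBO.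
apply: (@sum_bounded_powR _ (p + lb) (c3 * C) n0) => // n hn.
rewrite /bB opprD powRDk -mulrA -[leRHS]mulrA; apply: ler_wpM2l => //.
rewrite [leRHS]mulrCA; apply: ler_wpM2l; first exact: powR_ge0.
by apply: hC; exact: ltnW.
Qed.

Lemma budget_le gamma m k : 0 <= gamma -> 0 <= m ->
  noise_budget c1 c2 c3 gamma m k <= gamma ^+ 2 * bA k + gamma * bB k.
Proof.
move=> g0 m0; have h := step_le k g0 m0; have s0 := step_ge0 m k.+1 g0.
apply: lerD.
  rewrite /bA [leRHS]mulrA -[gamma ^+ 2 * _]exprMn; apply: ler_wpM2r.
    by rewrite addr_ge0 // mulr_ge0 // sqr_ge0.
  by apply: lerXn2r; rewrite ?nnegrE // (le_trans s0).
rewrite /bB [leRHS]mulrA [gamma * _]mulrCA; apply: ler_wpM2r => //.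
exact: ler_wpM2l.
Qed.

Lemma budget_small_gamma tol : 0 < tol -> exists gamma0 : R, 0 < gamma0 /\
  forall gamma m, 0 < gamma -> gamma <= gamma0 -> 0 <= m ->
  forall n, \sum_(0 <= k < n) noise_budget c1 c2 c3 gamma m k <= tol.
Proof.
move=> tol0; have [CA hA] := bA_sum; have [CB hB] := bB_sum.
have CA0 : 0 <= CA by have := hA 0%N; rewrite big_nil.
have CB0 : 0 <= CB by have := hB 0%N; rewrite big_nil.
(* The cap 1 gives [gamma ^+ 2 <= gamma], so both majorants scale with [gamma]; the added 1 keeps
   the denominator positive. *)
exists (Num.min 1 (tol / (CA + CB + 1))); split.
  by rewrite lt_min ltr01 divr_gt0 //; lra.
move=> gamma m g0; rewrite le_min => /andP[g1 g2] m0 n.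
apply: (@le_trans _ _ (\sum_(0 <= k < n) (gamma ^+ 2 * bA k + gamma * bB k))).
  by apply: ler_sum => k _; apply: budget_le => //; exact: ltW.
rewrite big_split -!mulr_sumr /=.
have h1 : gamma * (CA + CB + 1) <= tol by rewrite -ler_pdivlMr //; lra.
have a0 : 0 <= \sum_(0 <= k < n) bA k by exact: sumr_ge0.
have g2' : gamma ^+ 2 <= gamma by rewrite expr2 ler_piMr // ltW.
have := ler_wpM2r a0 g2'.
have := ler_wpM2l (ltW g0) (hA n); have := ler_wpM2l (ltW g0) (hB n).
lra.
Qed.

(** The tail is cut at an [N] independent of [m], thanks to the majorants free of [m]; the finitely
    many terms before [N] become small with [m] through one factor [step gamma m]. *)
Lemma budget_large_shift tol gamma : 0 < tol -> 0 < gamma -> exists m0 : R, 0 <= m0 /\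
  forall m, m0 <= m ->
  forall n, \sum_(0 <= k < n) noise_budget c1 c2 c3 gamma m k <= tol.
Proof.
move=> tol0 g0.
pose w k := gamma ^+ 2 * bA k + gamma * bB k.
have w0 k : 0 <= w k by rewrite addr_ge0 // mulr_ge0 ?sqr_ge0 // ltW.
have ws : sum_bounded w.
  have [CA hA] := bA_sum; have [CB hB] := bB_sum.
  exists (gamma ^+ 2 * CA + gamma * CB) => n; rewrite big_split -!mulr_sumr /=.
  by apply: lerD; apply: ler_wpM2l; rewrite ?sqr_ge0 // ltW.
have [N hN] := sum_bounded_tail w0 ws (divr_gt0 tol0 (ltr0n R 2)).
pose X k := gamma * k.+1%:R `^ (- p) * (c1 + c2 * sig k.+1 ^+ 2) + c3 * Bb k.+1.
have X0 k : 0 <= X k.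
  apply: addr_ge0; last exact: mulr_ge0.
  apply: mulr_ge0; first by apply: mulr_ge0; [exact: ltW|exact: powR_ge0].
  by rewrite addr_ge0 // mulr_ge0 // sqr_ge0.
pose SX := \sum_(0 <= k < N) X k.
have SX0 : 0 <= SX by exact: sumr_ge0.
pose th := tol / 2 / (gamma * (SX + 1)).
have th0 : 0 < th by rewrite !divr_gt0 // mulr_gt0 //; lra.
(* Then [m0] to the power [p] is [th^-1], so every step is at most [gamma * th]; and [th] was chosen
   to make [gamma * th * SX] at most [tol / 2]. *)
pose m0 := th^-1 `^ p^-1.
have m00 : 0 < m0 by rewrite powR_gt0 // invr_gt0.
exists m0; split; first exact: ltW.
move=> m hm n; have mp : 0 < m by exact: lt_le_trans hm.
have mth : (m `^ p)^-1 <= th.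
  rewrite -[leRHS]invrK lef_pV2 ?posrE ?powR_gt0 ?invr_gt0 //.
  have -> : th^-1 = m0 `^ p.
    by rewrite /m0 -powRrM mulVf ?gt_eqF // powRr1 // invr_ge0 ltW.
  by apply: ge0_ler_powR; [exact: ltW p0|rewrite nnegrE ltW|rewrite nnegrE ltW|].
have nb0 k : 0 <= noise_budget c1 c2 c3 gamma m k.
  apply: addr_ge0.
    by apply: mulr_ge0; [exact: sqr_ge0|rewrite addr_ge0 // mulr_ge0 // sqr_ge0].
  by apply: mulr_ge0 => //; apply: mulr_ge0 => //; apply: step_ge0; exact: ltW.
apply: (@le_trans _ _ (\sum_(0 <= k < N + n) noise_budget c1 c2 c3 gamma m k)).
  rewrite [leRHS](@big_cat_nat _ _ _ n) //= ?leq_addl //.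
  by rewrite lerDl sumr_ge0.
rewrite (@big_cat_nat _ _ _ N) //= ?leq_addr //.
have -> : tol = tol / 2 + tol / 2 by lra.
apply: lerD; last first.
  apply: le_trans (hN (N + n)%N); apply: ler_sum => k _.
  by apply: budget_le; exact: ltW.
apply: (@le_trans _ _ (gamma * th * SX)).
  rewrite mulr_sumr; apply: ler_sum => k _.
  have s0 := step_ge0 m k.+1 (ltW g0).
  have s1 := step_le k (ltW g0) (ltW mp).
  have s2 : step gamma m k.+1 <= gamma * th.
    apply: le_trans (step_le_shift k (ltW g0) mp) _.
    by apply: ler_wpM2l => //; exact: ltW.
  rewrite /X mulrDr; apply: lerD.
    rewrite [leRHS]mulrA; apply: ler_wpM2r.
      by rewrite addr_ge0 // mulr_ge0 // sqr_ge0.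
    by rewrite [leLHS]expr2; apply: ler_pM.
  rewrite [leRHS]mulrCA -mulrA; apply: ler_wpM2l => //; exact: ler_wpM2r.
have -> : gamma * th = tol / 2 / (SX + 1).
  rewrite /th; field; rewrite gt_eqF //=; lra.
rewrite mulrAC ler_pdivrMr; last lra.
apply: ler_wpM2l; lra.
Qed.

End StepSizes.

(** * The policy gradient process *)

Section StochasticGradient.
Context {R : realType} {N : nat} {S : finType} {A : 'I_N -> finType}.
Variables (r : forall i : 'I_N, S -> joint A -> R)
  (P : S -> S -> joint A -> R) (rho : S -> R).
Hypothesis hP : forall s' s a, 0 <= P s' s a.
Hypothesis hzeta : forall s a, 0 < 1 - \sum_(s' : S) P s' s a.
Context {d} {T : measurableType d} (Pr : probability T R).

(** The bound on a version [W] of the conditional expectation is integrated over events of the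
    sigma-algebra; the whole space yields the integrability of [Z]. *)
Lemma cexp_le_bound (gens : set (set T)) (Z : T -> R) (c : R) :
  (forall B, gens B -> measurable B) -> measurable_fun setT Z ->
  (forall w, 0 <= Z w) -> 0 <= c -> cexp_le Pr <<s gens >> Z c ->
  L1 Pr Z /\ forall B, <<s gens >> B ->
    Ex Pr (fun w => Z w * \1_B w) <= c * pr Pr B.
Proof.
move=> hgens mZ Z0 c0 [W [[mW [W0 hW]] haeW]].
have mWm : measurable_fun setT W.
  move=> _ B mB; rewrite setTI; apply: (sub_measurable hgens); exact: mW.
have key B : <<s gens >> B -> (\int[Pr]_(w in B) (Z w)%:E <= c%:E * Pr B)%E.
  move=> GB; have mB := sub_measurable hgens GB.
  rewrite hW // -integral_cst //; apply: ae_ge0_le_integral => //.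
  - exact: measurable_funTS.
  - by move: haeW; apply: filterS => w h _.
have LZ : L1 Pr Z.
  apply/integrableP; split; first exact/measurable_EFinP.
  apply: (@le_lt_trans _ _ (c%:E * Pr setT)%E).
    rewrite (eq_integral (fun w => (Z w)%:E)); last first.
      by move=> w _ /=; rewrite ger0_norm.
    apply: key; exact: (@measurableT _ (g_sigma_algebraType gens)).
  by rewrite (prE Pr measurableT) -EFinM ltry.
split=> // B GB; have mB := sub_measurable hgens GB.
by rewrite -lee_fin -integral_set_indic // EFinM -prE //; exact: key.
Qed.

Variables (pis : pol R S A) (gam Bb sig : nat -> R)
  (pin vhat : nat -> T -> pol R S A).
Hypotheses (hpis : Pi pis) (hgam : forall n, 0 <= gam n)
  (hB0 : forall n, 0 <= Bb n).
Hypothesis process : PG_process r P rho Pr gam Bb sig pin vhat.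

Let M : R := @dimc R N S A.

(* Indices are shifted by one: [history n] generates [Fsig pin n.+1] and
   [energy n] concerns the iterate [n.+1], the policy template starting at 1. *)
Definition history (n : nat) : set (set T) :=
  [set E | exists k x (B : set R), (1 <= k <= n.+1)%N /\ measurable B /\
     E = (fun w => pin k w x) @^-1` B].

Definition energy (n : nat) (w : T) : R :=
  inner (pin n.+1 w - pis) (pin n.+1 w - pis).

Let mpin n x : measurable_fun setT (fun w => pin n w x).
Proof. by have [h _] := process; exact: h. Qed.

Let mvhat n x : measurable_fun setT (fun w => vhat n w x).
Proof. by have [_ [h _]] := process; exact: h. Qed.

Lemma Pi_iterates n w : Pi (pin n.+1 w).
Proof.
have [_ [_ [h1 [hs _]]]] := process.
by case: n => [|n]; [exact: h1|have [] := hs n.+1 w isT].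
Qed.

Lemma history_measurable n B : history n B -> measurable B.
Proof.
move=> [k [x [C [_ [mC ->]]]]].
by have := mpin k x measurableT mC; rewrite setTI.
Qed.

Lemma history_mono n : history n `<=` history n.+1.
Proof.
move=> B [k [x [C [/andP[k1 kn] h]]]]; exists k, x, C; split => //.
by rewrite k1 (leq_trans kn).
Qed.

Lemma meas_wrt_coord n x : meas_wrt (history n) (fun w => (pin n.+1 w - pis) x).
Proof.
apply: measurable_funB => //; apply/meas_wrt_Gmeas => B mB.
by apply: sub_sigma_algebra; exists n.+1, x, B; rewrite leqnn.
Qed.

Lemma meas_wrt_energy n : meas_wrt (history n) (energy n).
Proof.
by apply: measurable_sum => x; apply: measurable_funM; exact: meas_wrt_coord.
Qed.

Lemma energy_bounds n w : 0 <= energy n w <= M.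
Proof. by rewrite inner_ge0 Pi_sqdist_le //; exact: Pi_iterates. Qed.

Variable (Gb : R).
Hypothesis hG : forall pi, Pi pi ->
  inner (grad r P rho pi) (grad r P rho pi) <= Gb.

Definition budget (n : nat) : R :=
  gam n.+1 ^+ 2 * (2 * Gb + 2 * sig n.+1 ^+ 2) + 4 * M * gam n.+1 * Bb n.+1.

(** [xi] is the noise paired with the current deviation, hence orthogonal to bounded weights known
    at time [n]. In [eta] the squared norm of [v + U] is replaced by [2 * Gb] plus twice that of
    [U], whose conditional mean is controlled. *)
Lemma energy_step n : exists xi eta : T -> R,
  [/\ L1 Pr eta, forall w, 0 <= eta w,
   (forall B, <<s history n >> B ->
      Ex Pr (fun w => eta w * \1_B w) <= budget n * pr Pr B),
   (forall w, (energy n.+1 w - energy n w) ^+ 2 <= 4 * M ^+ 2 * eta w) &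
   (forall w, energy n.+1 w <= energy n w
      + 2 * gam n.+1 * inner (grad r P rho (pin n.+1 w)) (pin n.+1 w - pis)
      + 2 * gam n.+1 * xi w + eta w) /\
   (forall h C, meas_wrt (history n) h -> (forall w, `|h w| <= C) ->
      L1 Pr (fun w => xi w * h w) /\ Ex Pr (fun w => xi w * h w) = 0)].
Proof.
have [_ [_ [_ [hs hc]]]] := process.
have [Y [hY [hb hU]]] := hc n.+1 isT.
have hgn := @history_measurable n.
pose v w : pol R S A := grad r P rho (pin n.+1 w).
pose U w : pol R S A := fun x => vhat n.+1 w x - Y w x.
pose b w : pol R S A := fun x => Y w x - v w x.
have mv x : measurable_fun setT (fun w => v w x).
  by apply: (measurable_grad r rho hP hzeta) => // w; exact: Pi_iterates.
have mY x : measurable_fun setT (fun w => Y w x).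
  by have [/meas_wrt_Gmeas h _] := hY x; exact: meas_wrt_measurable h.
have mU x : measurable_fun setT (fun w => U w x) by exact: measurable_funB.
have mb x : measurable_fun setT (fun w => b w x) by exact: measurable_funB.
have minner (f : T -> pol R S A) : (forall x, measurable_fun setT (fun w => f w x)) ->
    measurable_fun setT (fun w => inner (f w) (f w)).
  by move=> mf; apply: measurable_sum => x; exact: measurable_funM.
have mUU : measurable_fun setT (fun w => enorm (U w) ^+ 2).
  rewrite (_ : (fun w => _) = (fun w => inner (U w) (U w))); first exact: minner.
  by apply/funext => w; rewrite enorm_sqr.
have mbb : measurable_fun setT (fun w => enorm (b w)).
  apply: measurableT_comp; last exact: minner.
  by apply: continuous_measurable_fun; exact: sqrt_continuous.
have [LU bU] := cexp_le_bound hgn mUU (fun w => sqr_ge0 _) (sqr_ge0 _) hU.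
have [Lb bb] := cexp_le_bound hgn mbb (fun w => enorm_ge0 _) (hB0 _) hb.
pose g := gam n.+1.
pose eta w := g ^+ 2 * (2 * Gb + 2 * enorm (U w) ^+ 2) + 4 * M * g * enorm (b w).
have g0 : 0 <= g by exact: hgam.
have M0 : 0 <= M by exact: ler0n.
have le_eta w : g ^+ 2 * inner (v w + U w) (v w + U w) + 4 * g * M * enorm (b w)
    <= eta w.
  rewrite /eta; have -> : 4 * g * M = 4 * M * g by ring.
  rewrite lerD2r; apply: ler_wpM2l; first exact: sqr_ge0.
  rewrite inner_sqrD enorm_sqr; have := inner_amgm (v w) (U w).
  have := hG (Pi_iterates n w); rewrite -/(v w); lra.
have hproj w : is_proj (fun x => pin n.+1 w x + g * (v w x + b w x + U w x))
    (pin n.+2 w).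
  have := hs n.+1 w isT; congr is_proj; apply/funext => x.
  by rewrite /U /b -/g; ring.
pose xi w := inner (U w) (pin n.+1 w - pis).
exists xi, eta; split.
- rewrite /eta; apply: L1D; apply: L1Z => //.
  by apply: L1D; [exact: L1_cst|exact: L1Z].
- move=> w; apply: le_trans (le_eta w); apply: addr_ge0.
    by rewrite mulr_ge0 ?sqr_ge0 ?inner_ge0.
  by rewrite !mulr_ge0 ?enorm_ge0.
- move=> B GB; have mB := sub_measurable hgn GB.
  have iB : L1 Pr (\1_B : T -> R) by exact: L1_indic.
  have b1 w : `|\1_B w : R| <= 1.
    by have /andP[h1 h2] := indic_01 (R := R) B w; rewrite ger0_norm.
  have i1 : L1 Pr (fun w => enorm (U w) ^+ 2 * \1_B w) by exact: L1_mulr LU _ b1.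
  have i2 : L1 Pr (fun w => enorm (b w) * \1_B w) by exact: L1_mulr Lb _ b1.
  have -> : (fun w => eta w * \1_B w) = (fun w => (g ^+ 2 * (2 * Gb)) * \1_B w
      + (2 * g ^+ 2) * (enorm (U w) ^+ 2 * \1_B w)
      + (4 * M * g) * (enorm (b w) * \1_B w)).
    by apply/funext => w; rewrite /eta; ring.
  have j1 := L1Z (g ^+ 2 * (2 * Gb)) iB.
  have j2 := L1Z (2 * g ^+ 2) i1.
  have j3 := L1Z (4 * M * g) i2.
  rewrite (ExD (L1D j1 j2) j3) (ExD j1 j2) (ExZ _ iB) (ExZ _ i1) (ExZ _ i2).
  rewrite Ex_indic //.
  have h1 : 2 * g ^+ 2 * Ex Pr (fun w => enorm (U w) ^+ 2 * \1_B w)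
      <= 2 * g ^+ 2 * (sig n.+1 ^+ 2 * pr Pr B).
    by apply: ler_wpM2l (bU _ GB); rewrite mulr_ge0 ?sqr_ge0.
  have h2 : 4 * M * g * Ex Pr (fun w => enorm (b w) * \1_B w)
      <= 4 * M * g * (Bb n.+1 * pr Pr B).
    by apply: ler_wpM2l (bb _ GB); rewrite !mulr_ge0.
  rewrite /budget -/g; lra.
- move=> w; apply: le_trans (energy_increment hpis (Pi_iterates n w) g0 (hproj w)) _.
  by apply: ler_wpM2l (le_eta w); rewrite mulr_ge0 ?sqr_ge0.
split=> [w|h C mh hC].
  apply: le_trans (proj_step_energy hpis g0 (hproj w)) _.
  by rewrite lerD2l.
have cx x : meas_wrt (history n) (fun w => (pin n.+1 w - pis) x * h w).
  by apply: measurable_funM => //; exact: meas_wrt_coord.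
have bx x w : `|(pin n.+1 w - pis) x * h w| <= C.
  rewrite normrM -[leRHS]mul1r; apply: ler_pM => //.
  by apply: Pi_sub_bound => //; exact: Pi_iterates.
have L1x x : L1 Pr (fun w => (vhat n.+1 w x - Y w x) * ((pin n.+1 w - pis) x * h w)).
  have [_ [i1 [i2 _]]] := hY x.
  by apply: L1_mulr (bx x); [exact: L1B|apply: meas_wrt_measurable (cx x)].
(* Coordinate by coordinate, the deviation times [h] is a bounded weight measurable for the history,
   to which [cexp_orthogonal] applies. *)
have -> : (fun w => xi w * h w) = (fun w => \sum_x
    (vhat n.+1 w x - Y w x) * ((pin n.+1 w - pis) x * h w)).
  by apply/funext => w; rewrite /xi /inner mulr_suml; apply: eq_bigr => x _; rewrite mulrA.
split; first exact: L1_sum.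
rewrite Ex_sum // big1 // => x _.
exact: (cexp_orthogonal hgn (hY x) (cx x) (bx x)).
Qed.

Variables (R1 : R) (kap : R -> R).
Hypotheses (hkap : forall e, 0 < e -> 0 < kap e)
  (hneg : forall pi, Pi pi -> inner (pi - pis) (pi - pis) < R1 ->
      inner (grad r P rho pi) (pi - pis) <= 0)
  (hdrift : forall e pi, 0 < e -> Pi pi -> e <= inner (pi - pis) (pi - pis) <= R1 ->
      inner (grad r P rho pi) (pi - pis) <= - kap e).

Let M0 : 0 <= M. Proof. exact: ler0n. Qed.

Let B_energy n : bmeas (energy n).
Proof.
split; first exact: (meas_wrt_measurable (@history_measurable n) (@meas_wrt_energy n)).
by exists M => w; have /andP[h1 h2] := energy_bounds n w; rewrite ger0_norm.
Qed.

Lemma budget_ge0 n : 0 <= Gb -> 0 <= budget n.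
Proof.
move=> Gb0; apply: addr_ge0; last by rewrite !mulr_ge0.
apply: mulr_ge0; first exact: sqr_ge0.
by apply: addr_ge0; apply: mulr_ge0 => //; exact: sqr_ge0.
Qed.

(** Multiplying the energy inequality by [h] and integrating removes [xi]. Where the energy is below
    [e] no quantitative drift is available, and the sign given by [hneg] suffices. *)
Lemma energy_drift n h B C : meas_wrt (history n) h -> <<s history n >> B ->
  B `<=` [set w | energy n w < R1] -> 0 <= C ->
  (forall w, 0 <= h w <= C * \1_B w) -> forall e, 0 < e ->
  Ex Pr (fun w => h w * (energy n.+1 w - energy n w)) <=
    C * budget n * pr Pr B
    - gam n.+1 * (2 * kap e) * Ex Pr (fun w => h w * \1_[set w | e <= energy n w] w).
Proof.
move=> mh GB BR C0 hh e e0.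
have [xi [eta [Leta eta0 beta _ [step mart]]]] := energy_step n.
have hgn := @history_measurable n.
have mB := sub_measurable hgn GB.
have hC w : `|h w| <= C.
  have /andP[h1 h2] := hh w; rewrite ger0_norm //; apply: le_trans h2 _.
  by rewrite -[leRHS]mulr1; apply: ler_wpM2l => //; have /andP[] := indic_01 (R := R) B w.
have Bh : bmeas h by split; [exact: (meas_wrt_measurable hgn mh)|exists C].
have [Lxi Exi] := mart h C mh hC.
have mEe : measurable [set w | e <= energy n w].
  rewrite -[X in measurable X]setTI; apply: measurable_fun_le => //.
  by have [] := B_energy n.
have Bi := bmeas_indic (R := R) mEe.
have iB : L1 Pr (fun w => eta w * \1_B w).
  apply: (L1_mulr (C := 1)) => // w.
  by have /andP[h1 h2] := indic_01 (R := R) B w; rewrite ger0_norm.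
have L3 : L1 Pr (fun w => h w * \1_[set w | e <= energy n w] w).
  by apply: bmeas_L1; exact: bmeasM.
have K1 := L1Z C iB.
have K2 := L1Z (2 * gam n.+1) Lxi.
have K3 := L1Z (gam n.+1 * (2 * kap e)) L3.
rewrite -[C * budget n * pr Pr B]mulrA.
apply: (@le_trans _ _ (Ex Pr (fun w => (C * (eta w * \1_B w)
    + 2 * gam n.+1 * (xi w * h w))
    - gam n.+1 * (2 * kap e) * (h w * \1_[set w | e <= energy n w] w)))).
  apply: le_Ex.
  - by apply: bmeas_L1; apply: bmeasM => //; exact: bmeasB.
  - by apply: L1B => //; exact: L1D.
  move=> w; have /andP[h0 h1] := hh w.
  have [hB|hB] := pselect (B w); last first.
    have hw : h w = 0.
      apply/eqP; rewrite eq_le h0 andbT; apply: le_trans h1 _.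
      by rewrite indicE memNset ?mulr0.
    by rewrite hw !mul0r !mulr0 addr0 subr0 indicE memNset // !mulr0.
  move: h1; rewrite [\1_B w]indicE mem_set // !mulr1 => h1.
  have hR := BR _ hB.
  have s1 := step w.
  have dr : inner (grad r P rho (pin n.+1 w)) (pin n.+1 w - pis)
      <= - kap e * \1_[set w | e <= energy n w] w.
    rewrite indicE; case: (leP e (energy n w)) => he.
      rewrite mem_set // mulr1; apply: hdrift => //; first exact: Pi_iterates.
      by rewrite he ltW.
    rewrite memNset ?mulr0; last by move=> /=; rewrite leNgt he.
    by apply: hneg => //; exact: Pi_iterates.
  have dr2 := ler_wpM2l (mulr_ge0 (ler0n R 2) (hgam n.+1)) dr.
  have eh : h w * eta w <= C * eta w by exact: ler_wpM2r.
  have s2 : energy n.+1 w - energy n w <=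
     2 * gam n.+1 * (- kap e * \1_[set w | e <= energy n w] w)
     + 2 * gam n.+1 * xi w + eta w by lra.
  have := ler_wpM2l h0 s2; lra.
rewrite (ExB (L1D K1 K2) K3) (ExD K1 K2) (ExZ _ Lxi) Exi mulr0 addr0 (ExZ _ L3) (ExZ _ iB).
by rewrite lerD2r; apply: ler_wpM2l => //; exact: beta.
Qed.

Lemma energy_increments n B : <<s history n >> B ->
  Ex Pr (fun w => \1_B w * (energy n.+1 w - energy n w) ^+ 2)
    <= 4 * M ^+ 2 * budget n * pr Pr B.
Proof.
move=> GB; have [xi [eta [Leta eta0 beta incr _]]] := energy_step n.
have mB := sub_measurable (@history_measurable n) GB.
have iB : L1 Pr (fun w => eta w * \1_B w).
  apply: (L1_mulr (C := 1)) => // w.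
  by have /andP[h1 h2] := indic_01 (R := R) B w; rewrite ger0_norm.
have c0 : 0 <= 4 * M ^+ 2 by rewrite mulr_ge0 ?sqr_ge0.
apply: (@le_trans _ _ (Ex Pr (fun w => 4 * M ^+ 2 * (eta w * \1_B w)))).
  apply: le_Ex.
  - by apply: bmeas_L1; apply: bmeasM; [exact: bmeas_indic|apply: bmeasX; exact: bmeasB].
  - exact: L1Z.
  - by move=> w; rewrite mulrA mulrC; exact: ler_wpM2r.
rewrite (ExZ _ iB) -[leRHS]mulrA; apply: ler_wpM2l => //; exact: beta.
Qed.

Lemma policy_gradient_convergence (tol delta : R) : 0 < R1 -> 0 <= Gb ->
  (forall n, \sum_(0 <= k < n) budget k <= tol) ->
  (forall m c, exists n, c < \sum_(m <= k < n) gam k.+1) ->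
  (2 * M + 1) * ((1 + 4 * M ^+ 2) * tol) <= delta * (R1 - R1 / 4) ^+ 2 ->
  ((1 - delta)%:E * Pr [set w | (energy 0 w < R1 / 4)%R] <=
   Pr [set w | (energy 0 w < R1 / 4)%R /\
       ((fun n => energy n w) @ \oo --> (0 : R))%R])%E.
Proof.
move=> R10 Gb0 hsum hdiv hd.
have c0 : 0 <= 4 * M ^+ 2 by rewrite mulr_ge0 ?sqr_ge0.
(* The factor [1 + 4 * M ^+ 2] lets one error sequence dominate both the drift error [budget n] and
   the squared increments, of size [4 * M ^+ 2 * budget n]. *)
apply: (@descent_convergence _ _ _ Pr history energy M R1
  ((1 + 4 * M ^+ 2) * tol) (fun n => gam n.+1)
  (fun n => (1 + 4 * M ^+ 2) * budget n) (fun e => 2 * kap e)) => //.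
- exact: history_measurable.
- exact: history_mono.
- exact: energy_bounds.
- exact: meas_wrt_energy.
- by move=> e e0; rewrite mulr_gt0 ?hkap.
- by move=> n; rewrite mulr_ge0 ?budget_ge0 // addr_ge0.
- move=> n h B C mh GB BR C0 hh e e0.
  apply: le_trans (energy_drift mh GB BR C0 hh e0) _; rewrite lerD2r.
  apply: ler_wpM2r; first exact: pr_ge0.
  by apply: ler_wpM2l => //; rewrite mulrDl mul1r lerDl mulr_ge0 ?budget_ge0.
- move=> n B GB; apply: le_trans (energy_increments GB) _.
  apply: ler_wpM2r; first exact: pr_ge0.
  by apply: ler_wpM2r; [exact: budget_ge0|rewrite lerDr].
- by move=> n; rewrite -mulr_sumr; apply: ler_wpM2l; [exact: addr_ge0|exact: hsum].
Qed.

End StochasticGradient.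

Unset Implicit Arguments.

Theorem theorem1
  (R : realType) (N : nat) (S : finType) (A : 'I_N -> finType)
  (r : forall i : 'I_N, S -> joint A -> R)
  (P : S -> S -> joint A -> R) (rho : S -> R)
  (hr : forall i s a, `|r i s a| <= 1)
  (hP : forall s' s a, 0 <= P s' s a)
  (hzeta : forall s a, 0 < 1 - \sum_(s' : S) P s' s a)
  (hrho0 : forall s, 0 <= rho s) (hrho1 : \sum_(s : S) rho s = 1)
  (pis : pol R S A) (hpis : is_stable_Nash r P rho pis)
  (p lb ls : R) (hp : 1 / 2 < p <= 1)
  (hplb : 1 < p + lb) (hpls : 1 / 2 < p - ls)
  (Bb sig : nat -> R)
  (hB0 : forall n, 0 <= Bb n) (hsig0 : forall n, 0 <= sig n)
  (hBO : exists C n0, forall n, (n0 <= n)%N ->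
           Bb n <= C * (n%:R `^ (- lb)))
  (hsigO : exists C n0, forall n, (n0 <= n)%N ->
           sig n <= C * (n%:R `^ ls)) :
  exists U : set (pol R S A), nbhd_in_Pi pis U /\
  forall delta : R, 0 < delta ->
    let good (gamma m : R) :=
      forall (d : measure_display) (T : measurableType d)
             (Pr : probability T R) (pin vhat : nat -> T -> pol R S A),
        PG_process r P rho Pr
          (fun n => gamma / (n%:R + m) `^ p) Bb sig pin vhat ->
        ((1 - delta)%:E * Pr [set w | U (pin 1%N w)] <=
         Pr [set w | U (pin 1%N w) /\
                     ((fun n => enorm (fun x => pin n w x - pis x)) @ \oo --> (0 : R))%R])%E
    in
    (* gamma small enough (for any m >= 0) ... *)
    (exists gamma0 : R, 0 < gamma0 /\
       forall gamma m : R, 0 < gamma -> gamma <= gamma0 -> 0 <= m -> good gamma m) /\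
    (* ... or m large enough (for any gamma > 0) *)
    (forall gamma : R, 0 < gamma ->
       exists m0 : R, 0 <= m0 /\ forall m : R, m0 <= m -> good gamma m).
Proof.
have [[hpisPi _] [eps [eps0 hstab]]] := hpis.
have [Gb Gb0 hG] := grad_bounded r rho hP hzeta.
(* [R1] is a squared radius; the factor 1/2 keeps the closed annuli inside the open stability
   ball. *)
pose R1 := eps ^+ 2 / 2.
have e20 : 0 < eps ^+ 2 by exact: exprn_gt0.
have R10 : 0 < R1 by rewrite divr_gt0.
have R1e : R1 < eps ^+ 2 by rewrite /R1; lra.
have R140 : 0 < R1 / 4 by rewrite divr_gt0.
have db := drift_bound hP hzeta eps0 hpisPi hstab.
have /choice[kap hkap] : forall e : R, exists k : R, 0 < e -> 0 < k /\
    forall pi, Pi pi -> e <= inner (pi - pis) (pi - pis) <= R1 ->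
      inner (grad r P rho pi) (pi - pis) <= - k.
  move=> e; have [e0|e0] := pselect (0 < e); last by exists 0.
  by have [k k0 hk] := db e R1 e0 R1e; exists k.
have hneg pi : Pi pi -> inner (pi - pis) (pi - pis) < R1 ->
    inner (grad r P rho pi) (pi - pis) <= 0.
  move=> hpi hE; have [->|ne] := eqVneq pi pis.
    by rewrite subrr /inner big1 // => x _; rewrite mulr0.
  apply/ltW/hstab => //.
  by rewrite -(@ltr_pXn2r _ 2) ?nnegrE ?enorm_ge0 ?(ltW eps0) // enorm_sqr (lt_trans hE).
pose M : R := @dimc R N S A.
have M0 : 0 <= M by exact: ler0n.
exists [set pi | Pi pi /\ inner (pi - pis) (pi - pis) < R1 / 4]; split.
  split; first by move=> pi [].
  exists (Num.sqrt (R1 / 4)); split; first by rewrite sqrtr_gt0.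
  move=> pi [hpi hd]; split => //.
  rewrite -enorm_sqr -[R1 / 4]sqr_sqrtr ?(ltW R140) //.
  by rewrite ltr_pXn2r ?nnegrE ?enorm_ge0 ?sqrtr_ge0.
move=> delta delta0 good.
pose tol := delta * (R1 - R1 / 4) ^+ 2 / ((2 * M + 1) * (1 + 4 * M ^+ 2)).
have c10 : 0 < 2 * M + 1 by apply: ltr_wpDl => //; exact: mulr_ge0.
have c20 : 0 < 1 + 4 * M ^+ 2.
  by apply: ltr_pwDl => //; apply: mulr_ge0 => //; exact: sqr_ge0.
have q0 : 0 < (R1 - R1 / 4) ^+ 2 by apply: exprn_gt0; lra.
have tol0 : 0 < tol by apply: divr_gt0; exact: mulr_gt0.
have htol : (2 * M + 1) * ((1 + 4 * M ^+ 2) * tol) <= delta * (R1 - R1 / 4) ^+ 2.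
  by rewrite mulrA /tol mulrC divfK // gt_eqF // mulr_gt0.
(* Both ways of tuning the steps act only through this bound on the total; the three constants make
   [noise_budget] coincide with [budget]. *)
have goodP gamma m : 0 < gamma -> 0 <= m ->
    (forall n, \sum_(0 <= k < n)
       noise_budget p Bb sig (2 * Gb) 2 (4 * M) gamma m k <= tol) -> good gamma m.
  move=> g0 m0 hsum d T Pr pin vhat process.
  have sg n : 0 <= gamma / (n%:R + m) `^ p by rewrite divr_ge0 ?powR_ge0 // ltW.
  have hk0 e : 0 < e -> 0 < kap e by move=> /hkap[].
  have hk1 e pi : 0 < e -> Pi pi -> e <= inner (pi - pis) (pi - pis) <= R1 ->
      inner (grad r P rho pi) (pi - pis) <= - kap e.
    by move=> /hkap[_]; exact.
  have := policy_gradient_convergence hP hzeta hpisPi sg hB0 process hG hk0 hneg hk1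
    R10 Gb0 hsum (step_divergence hp g0 m0) htol.
  have PiN := Pi_iterates process.
  have -> : [set w | [set pi | Pi pi /\ inner (pi - pis) (pi - pis) < R1 / 4] (pin 1%N w)]
      = [set w | energy pis pin 0 w < R1 / 4].
    by apply/seteqP; split => w /= => [[]|h]; [|split].
  (* The two events agree up to an index shift, the energy being the squared norm of the
     deviation. *)
  congr (_ <= Pr _)%E; apply/seteqP; split => w /= [h1 h2].
    split; first by split.
    rewrite -cvg_shiftS.
    have -> : (fun n => enorm (fun x => pin n.+1 w x - pis x)) =
        (fun n => Num.sqrt (energy pis pin n w)) by [].
    have h3 := continuous_cvg _ (@sqrt_continuous R 0) h2.
    by rewrite sqrtr0 in h3; exact: (h3 _).
  have [_ hE] := h1; split => //.
  rewrite -cvg_shiftS in h2.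
  have -> : (fun n => energy pis pin n w) =
      (fun n => enorm (pin n.+1 w - pis) * enorm (pin n.+1 w - pis)).
    by apply/funext => n; rewrite -expr2 enorm_sqr.
  by rewrite -(mulr0 (0 : R)); apply: cvgM.
have c1 : 0 <= 2 * Gb by rewrite mulr_ge0.
have c3 : 0 <= 4 * M by rewrite mulr_ge0.
split.
  have [gamma0 [g00 hg]] :=
    budget_small_gamma hp hplb hpls hB0 hsig0 hBO hsigO c1 (ler0n R 2) c3 tol0.
  exists gamma0; split => // gamma m g0 gg m0.
  by apply: goodP => //; exact: hg.
move=> gamma g0.
have [m0 [m00 hm]] :=
  budget_large_shift hp hplb hpls hB0 hsig0 hBO hsigO c1 (ler0n R 2) c3 tol0 g0.
exists m0; split => // m mm.
by apply: goodP => //; [exact: le_trans mm|exact: hm].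
Qed.
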